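(* Let $p\ge3$, $n\ge1$, and let $X\sim N_p(\theta,\sigma^2I_p)$ and $Z\sim N_n(0,\sigma^2I_n)$ be independent, with $\theta\in\mathbb{R}^p$, $\sigma>0$ unknown; let $S=Z'Z$, $W=\|X\|^2/S$. For real $a,b,e$ consider the generalized Bayes estimator $\delta=(1-\phi(W)/W)X$ with $$\phi(w)=w\,\frac{\int_0^1\lambda^{p/2+a+1}(1-\lambda)^b(1+w\lambda)^{-p/2-n/2-e-2}\,d\lambda}{\int_0^1\lambda^{p/2+a}(1-\lambda)^b(1+w\lambda)^{-p/2-n/2-e-2}\,d\lambda}.$$ Suppose $e>-p/2-n/2-1$, and let $c(p,n)=2(p-2)/(n+2)$ and $\alpha=(p/2+a+1)/(n/2+e-a)$. (i) If $-p/2-1<a\le\frac{c(p,n)(n/2+e)-p/2-1}{1+c(p,n)}$ and $b\ge\min(n/2+e-a-1,0)$, then $\delta$ is minimax. (ii) If $-p/2-1<a<\frac{c(p,n)(n/2+e)-p/2-1}{1+c(p,n)}$ and $$-1<-(n+2)\frac{c(p,n)-\alpha}{4(p+a+1)(\alpha+1)}\le b<\min(0,\,n/2+e-a-1),$$ then $\delta$ is minimax.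
   Context: $\delta$ is the generalized Bayes estimator $E(\eta\theta\mid X,S)/E(\eta\mid X,S)$, $\eta=1/\sigma^2$, under the hierarchical prior $\theta\mid\eta,\lambda\sim N_p(0,\eta^{-1}(1-\lambda)\lambda^{-1}I_p)$, $\eta\sim\eta^e$, $\lambda\sim\lambda^a(1-\lambda)^b$ on $(0,1)$. Minimaxity is for estimating $\theta$ under the loss $(\delta-\theta)'(\delta-\theta)/\sigma^2$; $X$ is minimax with constant risk, so $\delta$ is minimax iff its risk is at most that of $X$ for all $\theta,\sigma^2$. *)

(* Defs.v *)
From HB Require Import structures.
From mathcomp Require Import all_boot all_order all_algebra.
From mathcomp Require Import all_classical all_reals all_analysis.
Set Implicit Arguments. Unset Strict Implicit. Unset Printing Implicit Defensive.
Import Order.TTheory GRing.Theory Num.Theory.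
Import numFieldNormedType.Exports.
Local Open Scope classical_set_scope.
Local Open Scope ring_scope.

Section Defs.
Variable R : realType.

Definition upd (v : nat -> R) (k : nat) (x : R) : nat -> R :=
  fun i => if i == k then x else v i.

(* iterated Lebesgue integral over coordinates 0..k-1 of R^k
   (for nonnegative measurable integrands this is, by Tonelli,
    the integral w.r.t. Lebesgue measure on R^k) *)
Fixpoint iter_int (k : nat) (F : (nat -> R) -> \bar R) : \bar R :=
  match k with
  | 0 => F (fun _ => 0)
  | k'.+1 => (\int[@lebesgue_measure R]_x iter_int k' (fun v => F (upd v k' x)))%E
  end.

Definition gauss (m s x : R) : R :=
  (Num.sqrt (2 * pi) * s)^-1 * expR (- ((x - m) ^+ 2) / (2 * s ^+ 2)).

Definition sqnorm (k : nat) (v : nat -> R) : R := \sum_(i < k) v i ^+ 2.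

(* Risk of an estimator est(X,S) of theta under loss ||est - theta||^2/sigma^2,
   X ~ N_p(theta, sigma^2 I_p), Z ~ N_n(0, sigma^2 I_n) independent, S = Z'Z. *)
Definition risk (p n : nat) (est : (nat -> R) -> R -> (nat -> R))
  (theta : nat -> R) (sigma : R) : \bar R :=
  iter_int p (fun x => iter_int n (fun z =>
    ((\prod_(i < p) gauss (theta i) sigma (x i)) *
     (\prod_(j < n) gauss 0 sigma (z j)) *
     ((\sum_(i < p) (est x (sqnorm n z) i - theta i) ^+ 2) / sigma ^+ 2))%:E)).

Definition est_X (x : nat -> R) (S : R) : nat -> R := x.

Definition gb_phi (p n : nat) (a b e w : R) : R :=
  let k := - (p%:R / 2 + n%:R / 2 + e + 2) in
  w * (Rintegral (@lebesgue_measure R) `[0, 1]%classic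
         (fun l => l `^ (p%:R / 2 + a + 1) * (1 - l) `^ b * (1 + w * l) `^ k))
    / (Rintegral (@lebesgue_measure R) `[0, 1]%classic
         (fun l => l `^ (p%:R / 2 + a) * (1 - l) `^ b * (1 + w * l) `^ k)).

Definition gb_delta (p n : nat) (a b e : R) (x : nat -> R) (S : R) : nat -> R :=
  let W := sqnorm p x / S in
  fun i => (1 - gb_phi p n a b e W / W) * x i.

(* minimax: risk at most that of X (which is minimax with constant risk) *)
Definition minimax (p n : nat) (est : (nat -> R) -> R -> (nat -> R)) : Prop :=
  forall (theta : nat -> R) (sigma : R), 0 < sigma ->
    (risk p n est theta sigma <= risk p n est_X theta sigma)%E.

End Defs.

(* Main.v *)
(** Write [h = p/2 + a + 1], [q = n/2 + e - a], and let [L = w phi'/phi] be the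
    logarithmic slope of [phi].  Stein's identity in each block, obtained by
    differentiating the dilation-invariant integrals at scale 1, gives
    [R(delta) - R(X) = - E (phi(W)/W) T(W)] with
    [T = 2 (p - 2) - (n + 2) phi + 4 (1 + phi) L], so it is enough that [T >= 0].
    Integration by parts in the beta-type integrals shows that [phi] solves the
    Riccati equation
    [(w + 1) L = h w / phi - q w - h + (q - b) phi - b].
    If [b >= min (q - 1, 0)], then [phi <= h / q] and [L >= 0] (for [b >= 0] by a
    barrier argument on the equation), and [h / q <= c] finishes the proof.
    If [b = - beta < 0], put [z = 1 - h (1 + 1/phi) / (h + q)] and
    [D = q - beta (q + h) > 0]; barriers give [z <= beta], i.e. [phi <= h / D], and,
    when [D > 1], [w z <= beta (h + 2 - beta) / (D - 1)].  These yield
    [(1 + phi) L >= - beta (q + h) (1 + h) / D], which is exactly what [T >= 0]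
    requires under the lower bound on [b]. *)

Require Import Defs.
From HB Require Import structures.
From mathcomp Require Import all_boot all_order all_algebra.
From mathcomp Require Import all_classical all_reals all_analysis.
From mathcomp Require Import measurable_realfun ring lra.
Set Implicit Arguments.
Unset Strict Implicit.
Unset Printing Implicit Defensive.
Import Order.TTheory GRing.Theory Num.Theory.
Import numFieldNormedType.Exports.
Local Open Scope classical_set_scope.
Local Open Scope ring_scope.

(** The Riccati equation degenerates at [w = 0], so no barrier argument can start from a value
    there. Each one starts on an interval []0, w0]] where the inequality is read off the integrals,
    through [phi w < w] and [(h + 1 + b) phi w <= h w].

    Dilations suit Stein's identity here because every function involved depends on a block only
    through its squared norm: scaling invariance of Lebesgue measure and one differentiation under
    the integral sign replace coordinatewise integration by parts. Gaussian domination then asks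
    that [g = phi/w], [w g^2], and [w] times their derivatives be bounded; this is the purpose of
    the bound on [phi] and of [|L - 1| <= h + q + 1].

    The loss difference is [(g^2 |X|^2 - 2 g (|X|^2 - X'theta)) / sigma^2] with [g] taken at [W].
    Since [g^2 |X|^2 = S (W g^2)], its first term is handled in the [Z] block with [X] fixed, its
    second in the [X] block with [Z] fixed. *)

Section Barrier.
Context {R : realType}.
Implicit Types (f df : R -> R) (w : R).

(** Suppose [f w1 > 0] and let [s] be the supremum of the points of [[w0, w1]] where [f <= 0].
    Continuity gives [f s <= 0], while [f > 0] and hence [df <= 0] beyond [s]; the mean value
    theorem on [[s, w1]] is then contradicted. *)
Lemma barrier_le0 f df w0 : 0 < w0 ->
  (forall w, 0 < w -> is_derive w 1 f (df w)) ->
  (forall w, 0 < w -> w <= w0 -> f w <= 0) ->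
  (forall w, 0 < w -> 0 < f w -> df w <= 0) ->
  forall w, 0 < w -> f w <= 0.
Proof.
move=> w00 fd f0 fdf w1 w10; rewrite leNgt; apply/negP => fw1.
have cf w : 0 < w -> {for w, continuous f}.
  by move=> w0'; apply/differentiable_continuous/derivable1_diffP; case: (fd _ w0').
have w01 : w0 < w1 by rewrite ltNge; apply/negP => w1w0; move: (f0 _ w10 w1w0); lra.
pose A := [set x | w0 <= x <= w1 /\ f x <= 0].
have A0 : A w0 by split; [rewrite lexx ltW|apply: f0].
have supA : has_sup A by split; [exists w0|exists w1 => x [/andP[]]].
set s := sup A.
have w0s : w0 <= s by apply: ub_le_sup => //; case: supA.
have sw1 : s <= w1 by apply: ge_sup; [exists w0|move=> x [/andP[]]].
have s0 : 0 < s by apply: lt_le_trans w0s.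
have fs : f s <= 0.
  rewrite leNgt; apply/negP => fs.
  have /cvgrPdist_lt/(_ _ fs)[e /= e0 He] := cf _ s0.
  have [x [/andP[w0x xw1] fx] sx] := sup_adherent e0 supA.
  have xs : x <= s by apply: ub_le_sup; [case: supA|split => //; rewrite w0x].
  have : `|s - x| < e by rewrite ger0_norm ?subr_ge0 // -/s in sx *; lra.
  by move=> /He; rewrite ger0_norm; lra.
have {}sw1 : s < w1.
  by rewrite lt_neqAle sw1 andbT; apply/eqP => sw; move: fs; rewrite sw; lra.
have fpos x : s < x -> x <= w1 -> 0 < f x.
  move=> sx xw1; rewrite ltNge; apply/negP => fx.
  suff : x <= s by lra.
  apply: ub_le_sup; first by case: supA.
  by split => //; rewrite xw1 andbT; lra.
have [||c] := @MVT _ f df _ _ sw1.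
- by move=> x; rewrite in_itv /= => /andP[sx _]; apply: fd; lra.
- apply: derivable_within_continuous => x; rewrite in_itv /= => /andP[sx _].
  by have [] := fd x (lt_le_trans s0 sx).
rewrite in_itv /= => /andP[sc cw1] E.
have := fdf c (lt_trans s0 sc) (fpos _ sc (ltW cw1)) => dc.
have : df c * (w1 - s) <= 0 by rewrite pmulr_lle0 // subr_gt0.
by rewrite -E; lra.
Qed.

End Barrier.

(** * Inequalities for solutions of the Riccati equation *)

Section Riccati.
Context {R : realType}.
Implicit Types w x y : R.
Variables (h q b : R) (phi : R -> R).
Hypotheses (h0 : 0 < h) (q0 : 0 < q) (b1 : -1 < b).

Ltac slra := move: (h0) (q0) (b1); lra.

(** The Riccati equation solved for [w phi' / phi]; the hypothesis [phi_der] says that [phi] is a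
    solution. *)
Definition logslope (w : R) :=
  (h * w / phi w - q * w - h + (q - b) * phi w - b) / (w + 1).

Hypothesis phi_gt0 : forall w : R, 0 < w -> 0 < phi w.
Hypothesis phi_lt : forall w : R, 0 < w -> phi w < w.
Hypothesis phi_der :
  forall w : R, 0 < w -> is_derive w 1 phi (phi w * logslope w / w).
Hypothesis phi_ub0 : forall w : R, 0 < w -> (h + 1 + b) * phi w <= h * w.

(** The factored form displays signs: as [0 < phi < w], the first term has the sign of [h - q phi]
    and the second that of [- b]. *)
Lemma logslopeE w : 0 < w -> (w + 1) * logslope w =
  (h - q * phi w) * (w - phi w) / phi w - b * (1 + phi w).
Proof.
move=> w0; have := phi_gt0 w0; rewrite /logslope => p0.
by field; do ?(apply/andP; split); slra.
Qed.

Lemma logslope_ge0_of_neg w : 0 < w -> b <= 0 -> q * phi w <= h ->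
  0 <= logslope w.
Proof.
move=> w0 b0 ph.
have w1 : 0 < w + 1 by slra.
rewrite -(pmulr_rge0 _ w1) logslopeE//.
have := phi_gt0 w0; have := phi_lt w0 => pw p0.
rewrite subr_ge0; apply: (@le_trans _ _ 0).
  by rewrite mulr_le0_ge0//; slra.
by rewrite divr_ge0//; [apply: mulr_ge0; slra|slra].
Qed.

(** Above the level [h / q] both terms of the factored slope are nonpositive, so [phi] cannot climb
    through it. Up to [w = h / q] the bound follows from [phi w < w]. *)
Lemma phi_le_of_ge0 : 0 <= b -> forall w : R, 0 < w -> q * phi w <= h.
Proof.
move=> b0 w w0; rewrite -subr_le0.
refine (@barrier_le0 R (fun w => q * phi w - h)
  (fun w => q * (phi w * logslope w / w)) (h / q) _ _ _ _ _ w0).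
- by rewrite divr_gt0.
- move=> x x0; have dphi := phi_der x0.
  by apply: is_derive_eq; rewrite /GRing.scale /=; ring.
- move=> x x0; rewrite ler_pdivlMr// => xh.
  by rewrite subr_le0; apply: le_trans xh; rewrite mulrC ler_pM2r// ltW// phi_lt.
- move=> x x0 H; have p0 := phi_gt0 x0; have pl := phi_lt x0.
  suff L : logslope x <= 0.
    rewrite pmulr_rle0// pmulr_lle0 ?invr_gt0//.
    by rewrite pmulr_rle0.
  have x1 : 0 < x + 1 by slra.
  rewrite -(pmulr_rle0 _ x1) logslopeE// subr_le0.
  apply: (@le_trans _ _ 0); last by apply: mulr_ge0; slra.
  by rewrite pmulr_lle0 ?invr_gt0//; rewrite nmulr_rle0; slra.
Qed.

(** The numerator [M] of the slope is nonnegative near [0] and has a nonnegative derivative wherever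
    it is negative, so it never becomes negative. *)
Lemma logslope_ge0_of_ge0 : 0 <= b -> forall w : R, 0 < w -> 0 <= logslope w.
Proof.
move=> b0.
pose M w := h * (w / phi w) - q * w - h + (q - b) * phi w - b.
have LM (w : R) : 0 < w -> logslope w = M w / (w + 1).
  by move=> w0; rewrite /logslope /M mulrA.
suff HM (w : R) : 0 < w -> - M w <= 0.
  by move=> w w0; rewrite LM// divr_ge0//; [move: (HM _ w0)|]; slra.
(* With this [N], [phi_ub0] yields [M x >= 1 - (q + N) x], which fixes the starting interval []0, (1
   + q + N)^-1]]. *)
have [N N0 HN] : exists2 N : R, 0 <= N & forall x : R, 0 < x -> - ((q - b) * phi x) <= N * x.
  exists `|q - b| => // x x0; apply: (le_trans (ler_norm _)); rewrite normrN normrM.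
  by apply: ler_wpM2l => //; rewrite gtr0_norm ?phi_gt0// ltW// phi_lt.
have N1 : 0 < 1 + q + N by rewrite ltr_wpDr// addr_gt0.
move=> w0.
refine (@barrier_le0 R (fun w => - M w)
  (fun w => - (h * ((1 - logslope w) / phi w) - q
      + (q - b) * (phi w * logslope w / w))) (1 + q + N)^-1 _ _ _ _ _ w0).
- by rewrite invr_gt0.
- move=> x x0; have dphi := phi_der x0; have p0 := phi_gt0 x0.
  have pn0 : phi x != 0 by rewrite gt_eqF.
  have div : is_derive x 1 (fun w => (phi w)^-1)
      (- (phi x) ^- 2 *: (phi x * logslope x / x)).
    exact: is_deriveV.
  rewrite /M; apply: is_derive_eq.
  rewrite /GRing.scale /=.
  by field; do ?(apply/andP; split); slra.
- move=> x x0; rewrite -div1r ler_pdivlMr// => xh; have p0 := phi_gt0 x0; have pl := phi_lt x0.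
  have := phi_ub0 x0; rewrite -ler_pdivlMr// -mulrA => X0.
  have := HN _ x0; have : 0 <= x by slra.
  by rewrite /M; slra.
- move=> x x0 H; have p0 := phi_gt0 x0; have pl := phi_lt x0.
  have pq := phi_le_of_ge0 b0 x0.
  have L0 : logslope x <= 0.
    by rewrite LM// pmulr_lle0 ?invr_gt0; slra.
  have hx : q * x <= h * x / phi x by rewrite ler_pdivlMr// mulrAC ler_pM2r.
  rewrite oppr_le0 -(pmulr_rge0 _ x0).
  (* In this regrouping both summands are nonnegative: the first by [q phi <= h], the second because
     [L <= 0] and [h x / phi >= q x >= q phi >= (q - b) phi]. *)
  have -> : x * (h * ((1 - logslope x) / phi x) - q +
      (q - b) * (phi x * logslope x / x)) =
    (h * x / phi x - q * x) + - logslope x * (h * x / phi x - (q - b) * phi x).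
    by field; do ?(apply/andP; split); slra.
  apply: addr_ge0; first slra.
  apply: mulr_ge0; first slra.
  have : q * phi x <= q * x by rewrite ler_pM2l// ltW.
  have : 0 <= b * phi x by rewrite mulr_ge0// ltW.
  by slra.
Qed.

Section NegativeExponent.
Variable beta : R.
Hypotheses (bE : b = - beta) (beta0 : 0 < beta).
Let D := q - beta * (q + h).
Hypothesis D0 : 0 < D.

Ltac nlra := move: (h0) (q0) (b1) (bE) (beta0) (D0); lra.

(** Equals [(q - h / phi) / (h + q)], so [z <= 0] means [q phi <= h]. Since [Dz = h / phi] takes the
    value [D] at [z = beta], the bound [z <= beta] means [D phi <= h]. *)
Let z w := 1 - h * (1 + (phi w)^-1) / (h + q).
Let Dz w := q - (q + h) * z w.

Let hq0 : 0 < h + q. Proof. by rewrite addr_gt0. Qed.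

Let DzE w : 0 < w -> Dz w = h / phi w.
Proof.
by move=> w0; rewrite /Dz /z; have := phi_gt0 w0 => p0; field; do ?(apply/andP; split); nlra.
Qed.

(* [z] straightens the Riccati equation: it satisfies
   [w (w + 1) z' = beta (1 - z) + h z - w z (q - (q + h) z)]. *)
Let slopeE w : 0 < w -> (w + 1) * logslope w =
  - (h + q) * (z w * w - (beta * (1 - z w) + h * z w) / Dz w).
Proof.
move=> w0; have := phi_gt0 w0 => p0.
rewrite DzE// /logslope /z bE.
by field; do ?(apply/andP; split); nlra.
Qed.

Let z_der w : 0 < w -> is_derive w 1 z
  ((beta * (1 - z w) + h * z w - z w * w * Dz w) / (w * (w + 1))).
Proof.
move=> w0; have dphi := phi_der w0; have p0 := phi_gt0 w0.
have pn0 : phi w != 0 by rewrite gt_eqF.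
have div : is_derive w 1 (fun w => (phi w)^-1)
    (- (phi w) ^- 2 *: (phi w * logslope w / w)).
  exact: is_deriveV.
have -> : (beta * (1 - z w) + h * z w - z w * w * Dz w) / (w * (w + 1)) =
   Dz w / (h + q) * logslope w / w.
  have L : logslope w = - (h + q) * (z w * w - (beta * (1 - z w) + h * z w) / Dz w) / (w + 1).
    by rewrite -slopeE//; field; nlra.
  have dz : Dz w != 0 by rewrite DzE// gt_eqF// divr_gt0.
  by rewrite L; field; do ?(apply/andP; split); first [exact: dz|nlra].
rewrite /z; apply: is_derive_eq.
rewrite DzE// /GRing.scale /=.
by field; do ?(apply/andP; split); nlra.
Qed.

(** Since [w Dz >= h + 1 - beta] by [phi_ub0], the equation for [z] gives [w (w + 1) z' <= beta - z]
    wherever [z > 0]: the level [beta] is a barrier. On []0, h / q]], [phi w < w] already forces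
    [z <= 0]. *)
Lemma phi_le_of_neg w : 0 < w -> D * phi w <= h.
Proof.
suff zb (x : R) : 0 < x -> z x <= beta.
  move=> w0; have p0 := phi_gt0 w0; have := zb _ w0.
  rewrite -ler_pdivlMr// -DzE// /Dz /D => ?.
  by rewrite lerD2l lerN2 mulrC ler_pM2r//; nlra.
move=> x0; rewrite -subr_le0.
refine (@barrier_le0 R (fun w => z w - beta) (fun w =>
  (beta * (1 - z w) + h * z w - z w * w * Dz w) / (w * (w + 1)))
  (h / q) _ _ _ _ _ x0).
- by rewrite divr_gt0.
- by move=> y y0; have dz := z_der y0; apply: is_derive_eq; rewrite /GRing.scale /=; ring.
- move=> y y0; rewrite ler_pdivlMr// => yh.
  have p0 := phi_gt0 y0; have pl := phi_lt y0.
  suff : z y <= 0 by nlra.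
  have : q <= Dz y by rewrite DzE// ler_pdivlMr//; apply: le_trans yh; rewrite mulrC ler_pM2r// ltW.
  by rewrite /Dz => ?; rewrite -(pmulr_rle0 _ hq0); nlra.
- move=> y y0 H.
  have p0 := phi_gt0 y0.
  have X0 : h + 1 - beta <= y * Dz y.
    by rewrite DzE// mulrA ler_pdivlMr// -bE [y * h]mulrC; apply: phi_ub0.
  rewrite pmulr_lle0 ?invr_gt0; last by apply: mulr_gt0; nlra.
  rewrite -mulrA.
  have : z y * (h + 1 - beta) <= z y * (y * Dz y) by rewrite ler_pM2l//; nlra.
  by nlra.
Qed.

Let z_le w : 0 < w -> z w <= beta.
Proof.
move=> w0; have p0 := phi_gt0 w0; have := phi_le_of_neg w0.
rewrite -ler_pdivlMr// -DzE// /Dz /D lerD2l lerN2 [beta * _]mulrC.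
by rewrite ler_pM2l//; nlra.
Qed.

Let D_le_Dz w : 0 < w -> D <= Dz w.
Proof.
move=> w0; have := z_le w0; rewrite /D /Dz => ?.
by rewrite lerD2l lerN2 mulrC ler_pM2r//; nlra.
Qed.

(** The barrier is the curve [c1 / w]. Above it, [z w Dz > c1 D] and [c1 / w < z], so with
    [z <= beta] the numerator of the derivative is at most
    [beta + (h + 1 - beta) beta - c1 (D - 1)]; [c1] is the constant making this zero. Up to
    [w = c1 / beta], [z <= beta] suffices. *)
Let z_decay w : 0 < w -> 1 < D -> z w * w <= beta * (h + 2 - beta) / (D - 1).
Proof.
move=> w0 D1.
set c1 := beta * _ / _.
have D10 : 0 < D - 1 by nlra.
have c10 : 0 < c1 by rewrite divr_gt0// mulr_gt0//; nlra.
rewrite -ler_pdivlMr// -subr_le0.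
refine (@barrier_le0 R (fun w => z w - c1 / w) (fun w =>
  (beta * (1 - z w) + h * z w - z w * w * Dz w) / (w * (w + 1)) + c1 / w ^+ 2)
  (c1 / beta) _ _ _ _ _ w0).
- by rewrite divr_gt0.
- move=> y y0; have dz := z_der y0.
  have yn0 : y != 0 by rewrite gt_eqF.
  have div : is_derive y 1 (fun w : R => w^-1) (- y ^- 2 *: 1).
    exact: is_deriveV.
  apply: is_derive_eq; rewrite /= /GRing.scale /=.
  by field; do ?(apply/andP; split); nlra.
- move=> y y0; rewrite ler_pdivlMr// => yb.
  rewrite subr_le0 ler_pdivlMr//; apply: le_trans yb.
  by rewrite mulrC ler_pM2l// z_le.
- move=> y y0; rewrite subr_gt0 => H.
  have -> : (beta * (1 - z y) + h * z y - z y * y * Dz y) / (y * (y + 1))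
     + c1 / y ^+ 2 = (beta * (1 - z y) + h * z y - z y * y * Dz y +
       (c1 + c1 / y)) / (y * (y + 1)).
    by field; do ?(apply/andP; split); nlra.
  rewrite pmulr_lle0 ?invr_gt0; last by apply: mulr_gt0; nlra.
  have zb := z_le y0.
  have z0 : 0 < z y by apply: lt_trans H; rewrite divr_gt0.
  have zy : c1 < z y * y by rewrite -ltr_pdivrMr.
  have E1 : z y * y * D <= z y * y * Dz y.
    by rewrite ler_pM2l ?D_le_Dz// mulr_gt0.
  have E2 : c1 * D <= z y * y * D by rewrite ler_pM2r// ltW.
  have E3 : c1 * (D - 1) = beta * (h + 2 - beta) by rewrite /c1; field; nlra.
  have : (h + 1 - beta) * z y <= (h + 1 - beta) * beta by rewrite ler_pM2l//; nlra.
  by nlra.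
Qed.

(** Only a negative slope needs work. With [V = - (w + 1) L / (h + q) > 0], the bound
    [D (1 + phi) <= D + h] reduces the claim to [(D + h) V <= beta (1 + h) (w + 1)]. *)
Lemma logslope_lower w : 0 < w ->
  - (beta * (q + h) * (1 + h)) <= D * ((1 + phi w) * logslope w).
Proof.
move=> w0.
have p0 := phi_gt0 w0.
have [L0|L0] := leP 0 (logslope w).
  apply: (@le_trans _ _ 0).
    by rewrite oppr_le0; do 2 (apply: mulr_ge0; last nlra); nlra.
  by rewrite mulr_ge0//; [nlra|rewrite mulr_ge0//; nlra].
have w1 : 0 < w + 1 by nlra.
set V := z w * w - (beta * (1 - z w) + h * z w) / Dz w.
have zb := z_le w0.
have DDz := D_le_Dz w0.
have Dz0 : 0 < Dz w by nlra.
have sE : (w + 1) * logslope w = - (h + q) * V by exact: slopeE.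
have V0 : 0 < V.
  have : (w + 1) * logslope w < 0 by rewrite pmulr_rlt0.
  by rewrite sE mulNr oppr_lt0 pmulr_rgt0.
(* A negative [z] would mean [q phi <= h], and the slope would be nonnegative by
   [logslope_ge0_of_neg]. *)
have z0 : 0 <= z w.
  rewrite leNgt; apply/negP => z0.
  have : logslope w >= 0.
    apply: logslope_ge0_of_neg => //; first nlra.
    by rewrite -ler_pdivlMr// -DzE// /Dz lerDl oppr_ge0 pmulr_rle0 ?ltW//; nlra.
  by nlra.
have phiE : 1 + phi w = (h + q) * (1 - z w) / Dz w.
  by rewrite DzE// /z; field; do ?(apply/andP; split); nlra.
have phi1 : D * (1 + phi w) <= D + h.
  have := phi_le_of_neg w0; nlra.
have DhE : D + h = (h + q) * (1 - beta) by rewrite /D; ring.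
(* The fraction subtracted in [V] cannot be discarded: this lower bound supplies the term
   [beta (1 - beta)] that closes the estimate of [(D + h) z w]. *)
have tlow : beta * (1 - beta) <= (D + h) * ((beta * (1 - z w) + h * z w) / Dz w).
  rewrite DhE mulrA ler_pdivlMr//.
  have -> : (h + q) * (1 - beta) * (beta * (1 - z w) + h * z w) =
    (1 - beta) * ((h + q) * (beta * (1 - z w) + h * z w)) by ring.
  rewrite [beta * (1 - beta)]mulrC -mulrA ler_pM2l; last nlra.
  rewrite /Dz; have : 0 <= beta * h by apply: mulr_ge0; nlra.
  have : 0 <= (h + q) * (h * z w) by apply: mulr_ge0; [nlra|apply: mulr_ge0; nlra].
  by nlra.
have VU : (D + h) * V <= beta * (1 + h) * (w + 1).
  rewrite /V mulrBr.
  suff : (D + h) * (z w * w) <= beta * (1 + h) * (w + 1) + beta * (1 - beta) by nlra.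
  have [D1|D1] := leP D 1.
    apply: (@le_trans _ _ ((1 + h) * (beta * w))).
      by apply: ler_pM; rewrite ?mulr_ge0//; try nlra; rewrite ler_pM2r.
    have : 0 <= beta * h by apply: mulr_ge0; nlra.
    have : 0 <= beta * (1 - beta) by apply: mulr_ge0; nlra.
    by nlra.
  have D10 : 0 < D - 1 by nlra.
  have zw1 := z_decay w0 D1.
  (* The bounds [z w <= beta w] and [z_decay] coincide at [w1']. There they give exactly the target,
     since [(D - 1) w1' = (1 + h) + (1 - beta)]; the first is used to the left of [w1'], the second
     to the right. *)
  set w1' := (h + 2 - beta) / (D - 1).
  have w1E : (D - 1) * w1' = h + 2 - beta by rewrite /w1'; field; nlra.
  have [ww|ww] := leP w w1'.
    apply: (@le_trans _ _ ((D + h) * (beta * w))).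
      by rewrite ler_pM2l; [rewrite ler_pM2r|nlra].
    have : (D - 1) * w <= (D - 1) * w1' by rewrite ler_pM2l.
    rewrite w1E => H.
    have : beta * ((D - 1) * w) <= beta * (h + 2 - beta) by rewrite ler_pM2l.
    by nlra.
  apply: (@le_trans _ _ ((D + h) * (beta * w1'))).
    by rewrite ler_pM2l; [rewrite /w1' mulrA|nlra].
  have : beta * (1 + h) * w1' <= beta * (1 + h) * w.
    by rewrite ler_pM2l; [nlra|rewrite mulr_gt0//; nlra].
  have : beta * ((D - 1) * w1') = beta * (h + 2 - beta) by rewrite w1E.
  by nlra.
rewrite -(ler_pM2l w1).
have -> : (w + 1) * (D * ((1 + phi w) * logslope w)) =
  D * (1 + phi w) * ((w + 1) * logslope w) by ring.
rewrite sE.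
have : D * (1 + phi w) * V <= (D + h) * V by rewrite ler_pM2r.
have : (h + q) * ((D + h) * V) <= (h + q) * (beta * (1 + h) * (w + 1)).
  by rewrite ler_pM2l.
move=> H1 H2.
have : (h + q) * (D * (1 + phi w) * V) <= (h + q) * ((D + h) * V).
  by rewrite ler_pM2l.
by nlra.
Qed.

End NegativeExponent.
End Riccati.

Lemma integrable_dominated {R : realType} (d : measure_display)
    (T : measurableType d) (mu : {measure set T -> \bar R}) (D : set T)
    (f g : T -> R) (C : R) :
  measurable D -> measurable_fun D f -> mu.-integrable D (EFin \o g) ->
  (forall x, D x -> `|f x| <= C * g x) -> mu.-integrable D (EFin \o f).
Proof.
move=> mD mf ig fg.
have : mu.-integrable D (fun x => (C%:E * (EFin \o g) x)%E) by exact: integrableZl.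
apply: le_integrable => //; first exact/measurable_EFinP.
by move=> x Dx /=; rewrite lee_fin; apply: le_trans (fg x Dx) (ler_norm _).
Qed.

(** Three terms cover the integration by parts, the final risk comparison and, with a zero
    coefficient, the two-term recurrences. *)
Lemma Rintegral_lin3 {R : realType} (d : measure_display)
    (T : measurableType d) (mu : {measure set T -> \bar R}) (D : set T)
    (f g1 g2 g3 : T -> R) (c1 c2 c3 : R) : measurable D ->
  mu.-integrable D (EFin \o g1) -> mu.-integrable D (EFin \o g2) ->
  mu.-integrable D (EFin \o g3) ->
  (forall x, D x -> f x = c1 * g1 x + c2 * g2 x + c3 * g3 x) ->
  mu.-integrable D (EFin \o f) /\
  Rintegral mu D f =
    c1 * Rintegral mu D g1 + c2 * Rintegral mu D g2 + c3 * Rintegral mu D g3.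
Proof.
move=> mD i1 i2 i3 fE.
have Z c g : mu.-integrable D (EFin \o g) ->
    mu.-integrable D (EFin \o (fun x => c * g x)).
  by move=> ig; exact: (integrableZl mD c ig).
have addi g g' : mu.-integrable D (EFin \o g) -> mu.-integrable D (EFin \o g') ->
    mu.-integrable D (EFin \o (fun x => g x + g' x)).
  by move=> ig ig'; exact: (integrableD mD ig ig').
have E : {in D, f =1 (fun x => c1 * g1 x + c2 * g2 x + c3 * g3 x)}.
  by move=> x; rewrite inE; exact: fE.
split.
  apply: (@eq_integrable _ _ _ mu _ mD
    (EFin \o (fun x => c1 * g1 x + c2 * g2 x + c3 * g3 x))).
    by move=> x xD /=; rewrite E.
  exact: addi (addi _ _ (Z _ _ i1) (Z _ _ i2)) (Z _ _ i3).
rewrite (eq_Rintegral _ E) RintegralD//; [|exact: addi (Z _ _ i1) (Z _ _ i2)|exact: Z].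
by rewrite RintegralD// ?RintegralZl//; apply: Z.
Qed.

(** * Integrating a derivative over the open unit interval *)

Section ImproperFTC.
Context {R : realType}.
Implicit Types x y : R.
Local Notation mu := (@lebesgue_measure R).

(** The offset 3 keeps the margin below [1/2], so every [inner_itv] is nondegenerate. *)
Definition margin (n : nat) : R := n.+3%:R^-1.

Definition inner_itv (n : nat) : set R := `[margin n, 1 - margin n]%classic.

Lemma inner_itv_bounds n : 0 < margin n /\ margin n < 1 - margin n.
Proof.
split; first by rewrite /margin invr_gt0.
have : margin n < 2^-1 by rewrite ltf_pV2 ?posrE// ltr_nat.
by lra.
Qed.

Lemma cvg_margin : margin n @[n --> \oo] --> (0 : R).
Proof.
have := @cvg_harmonic R; rewrite -(cvg_shiftn 2); apply: cvg_trans.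
by apply: near_eq_cvg; apply: nearW => n; rewrite /= addn2.
Qed.

Lemma subset_inner_itv n : inner_itv n `<=` `]0, 1[%classic.
Proof.
have [h1 h2] := inner_itv_bounds n.
by move=> x /=; rewrite /inner_itv /= !in_itv /= => /andP[? ?]; apply/andP; split; lra.
Qed.

Lemma mem_inner_itv x : 0 < x < 1 -> \forall n \near \oo, inner_itv n x.
Proof.
move=> /andP[x0 x1].
have cv := cvg_margin.
have y0 : 0 < Num.min x (1 - x) by rewrite lt_min x0 subr_gt0.
near=> n; rewrite /inner_itv /= in_itv /=.
have : margin n < Num.min x (1 - x) by near: n; exact: (cvgr_lt _ cv).
by rewrite lt_min => /andP[? ?]; apply/andP; split; lra.
Unshelve. all: by end_near.
Qed.

Lemma bigcup_inner_itv : \bigcup_n inner_itv n = `]0, 1[%classic.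
Proof.
apply/seteqP; split => [x [n _]|x /=]; first exact: subset_inner_itv.
rewrite in_itv /= => /mem_inner_itv [N _ /(_ N (leqnn _)) H].
by exists N.
Qed.

Lemma nondecreasing_inner_itv : nondecreasing_seq inner_itv.
Proof.
move=> m n mn; rewrite subsetEset => x; rewrite /inner_itv /= !in_itv /=.
move=> /andP[h1 h2].
have h : margin n <= margin m by rewrite lef_pV2 ?posrE// ler_nat.
by apply/andP; split; lra.
Qed.

Variables F f : R -> R.
Hypothesis dF : forall x, 0 < x < 1 -> is_derive x 1 F (f x).
Hypothesis cf : forall x, 0 < x < 1 -> {for x, continuous f}.

Lemma measurable_fun_continuous_oo01 : measurable_fun (`]0, 1[%classic : set R) f.
Proof.
apply: open_continuous_measurable_fun => //.
by move=> x; rewrite inE /= in_itv /=; exact: cf.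
Qed.

Lemma integral_inner_itv n : (\int[mu]_(x in inner_itv n) (f x)%:E =
  (F (1 - margin n) - F (margin n))%:E)%E.
Proof.
have [h1 h2] := inner_itv_bounds n.
have cF x : 0 < x < 1 -> {for x, continuous F}.
  by move=> x01; apply/differentiable_continuous/derivable1_diffP; case: (dF x01).
rewrite (@continuous_FTC2 _ f F)//.
- apply: continuous_in_subspaceT => x; rewrite inE => /subset_inner_itv.
  by rewrite /= in_itv /= => /cf.
- split.
  + move=> x; rewrite in_itv /= => /andP[xa xb].
    by have [] : is_derive x 1 F (f x) by apply: dF; apply/andP; split; lra.
  + by apply: cvg_at_right_filter; apply: cF; apply/andP; split; lra.
  + by apply: cvg_at_left_filter; apply: cF; apply/andP; split; lra.
- move=> x; rewrite in_itv /= => /andP[xa xb]; rewrite derive1E.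
  by have [] : is_derive x 1 F (f x) by apply: dF; apply/andP; split; lra.
Qed.

(** The integrals over the inner intervals are increments of [F], hence at most [2 C], and monotone
    convergence passes to []0, 1[]. *)
Lemma integrable_oo01_ge0 (C : R) : (forall x, 0 < x < 1 -> 0 <= f x) ->
  (forall x, 0 < x < 1 -> `|F x| <= C) ->
  mu.-integrable `]0%R, 1%R[ (EFin \o f).
Proof.
move=> f0 FC.
have mf := measurable_fun_continuous_oo01.
apply/integrableP; split; first exact/measurable_EFinP.
have -> : (\int[mu]_(x in `]0%R, 1%R[) `|(EFin \o f) x| =
           \int[mu]_(x in `]0%R, 1%R[) (f x)%:E)%E.
  apply: eq_integral => x; rewrite inE /= in_itv /= => x01.
  by rewrite ger0_norm// f0.
apply: (@le_lt_trans _ _ (C + C)%:E); last by rewrite ltry.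
rewrite -bigcup_inner_itv.
have cv : (\int[mu]_(x in inner_itv i) (f x)%:E)%E @[i --> \oo] -->
    (\int[mu]_(x in \bigcup_i inner_itv i) (f x)%:E)%E.
  apply: ge0_nondecreasing_set_cvg_integral.
  - exact: nondecreasing_inner_itv.
  - by move=> i; exact: measurable_itv.
  - move=> i; apply/measurable_EFinP; apply: measurable_funS mf => //.
    exact: subset_inner_itv.
  - by move=> i x /subset_inner_itv; rewrite /= in_itv /= lee_fin; exact: f0.
rewrite -(cvg_lim _ cv)//; apply: lime_le; first by apply/cvg_ex; eexists; exact: cv.
apply: nearW => n; rewrite integral_inner_itv lee_fin.
have [h1 h2] := inner_itv_bounds n.
apply: (le_trans (ler_norm _)); apply: (le_trans (ler_normB _ _)).
by apply: lerD; apply: FC; apply/andP; split; lra.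
Qed.

(** Integration by parts without boundary terms, for an [f] that may blow up at both ends: the
    increments of [F] over the inner intervals tend to [0], and [|f|] dominates. *)
Lemma integral_oo01_eq0 : mu.-integrable `]0%R, 1%R[ (EFin \o f) ->
  F x @[x --> 0^'+] --> 0 -> F x @[x --> 1^'-] --> 0 ->
  (\int[mu]_(x in `]0%R, 1%R[) (f x)%:E = 0)%E.
Proof.
move=> intf F0 F1.
have cv := cvg_margin.
have cv0 : F (margin n) @[n --> \oo] --> 0.
  move/cvg_at_rightP : F0; apply; split => // n.
  by have [] := inner_itv_bounds n.
have cv1 : F (1 - margin n) @[n --> \oo] --> 0.
  move/cvg_at_leftP : F1; apply; split => [n|].
    by rewrite ltrBlDr ltrDl; have [] := inner_itv_bounds n.
  by rewrite -[X in _ --> X]subr0; apply: cvgB => //; exact: cvg_cst.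
have lim0 : (F (1 - margin n) - F (margin n))%:E @[n --> \oo] --> (0 : \bar R)%E.
  apply: cvg_EFin; first exact: nearW.
  by rewrite -[X in _ --> X](subr0 (0 : R)); exact: cvgB.
have mf := measurable_fun_continuous_oo01.
have dc : (\int[mu]_(x in `]0%R, 1%R[) ((EFin \o f) \_ (inner_itv n)) x)%E @[n --> \oo]
    --> (\int[mu]_(x in `]0%R, 1%R[) (f x)%:E)%E.
  apply: (@dominated_cvg _ _ _ mu _ _
    (fun n => (EFin \o f) \_ (inner_itv n)) _ (fun x => `|f x|%:E)) => //.
  - move=> n; apply/(measurable_restrict _ _ _) => //; first exact: measurable_itv.
    apply/measurable_EFinP; apply: measurable_funS mf => //.
  - move=> x /=; rewrite in_itv /= => x01.
    apply: cvg_near_cst; near=> n; rewrite patchE mem_set//.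
    by near: n; exact: mem_inner_itv.
  - by have := integrable_abse intf; apply: eq_integrable.
  - move=> n x _; rewrite patchE; case: ifPn => _ //=.
    by rewrite normr0 lee_fin.
have e2 n : (\int[mu]_(x in `]0%R, 1%R[) ((EFin \o f) \_ (inner_itv n)) x)%E =
    (F (1 - margin n) - F (margin n))%:E.
  rewrite -integral_mkcondr setIidr; last exact: subset_inner_itv.
  exact: integral_inner_itv.
rewrite (eq_cvg _ _ e2) in dc.
exact: cvg_unique dc lim0.
Unshelve. all: by end_near.
Qed.

End ImproperFTC.

(** * The beta-type kernel: derivative, bounds and integrability *)

Section BetaKernel.
Context {R : realType}.
Implicit Types x y l w A B G : R.
Local Notation mu := (@lebesgue_measure R).

Definition bker A B G w l : R := l `^ A * (1 - l) `^ B * (1 + w * l) `^ G.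

Definition bint A B G w : R := Rintegral mu `]0%R, 1%R[%classic (bker A B G w).

Lemma powRS x A : 0 < x -> x `^ (A + 1) = x * x `^ A.
Proof.
move=> x0; rewrite powRD; first by rewrite powRr1 ?ltW// mulrC.
by apply/implyP => _; rewrite gt_eqF.
Qed.

Lemma bker_gt0 A B G w l : 0 <= w -> 0 < l < 1 -> 0 < bker A B G w l.
Proof.
move=> w0 /andP[l0 l1]; rewrite /bker !mulr_gt0// powR_gt0 ?subr_gt0//.
by rewrite ltr_wpDr// mulr_ge0// ltW.
Qed.

Lemma bkerSl A B G w l : 0 < l -> bker (A + 1) B G w l = l * bker A B G w l.
Proof. by move=> l0; rewrite /bker powRS// !mulrA. Qed.

Lemma bkerSm A B G w l : l < 1 -> bker A (B + 1) G w l = (1 - l) * bker A B G w l.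
Proof. by move=> l1; rewrite /bker powRS ?subr_gt0//; ring. Qed.

Lemma bkerSr A B G w l : 0 <= w -> 0 < l ->
  bker A B (G + 1) w l = (1 + w * l) * bker A B G w l.
Proof.
move=> w0 l0; rewrite /bker powRS; first ring.
by rewrite ltr_wpDr// mulr_ge0// ltW.
Qed.

Lemma is_derive_bker A B G w l : 0 <= w -> 0 < l < 1 ->
  is_derive l 1 (bker A B G w) (bker (A - 1) (B - 1) (G - 1) w l *
    (A * (1 - l) * (1 + w * l) - B * l * (1 + w * l) + G * w * l * (1 - l))).
Proof.
move=> w0 l01; have /andP[l0 l1] := l01.
have wl0 : 0 < 1 + w * l by rewrite ltr_wpDr// mulr_ge0// ltW.
have l1' : 0 < 1 - l by rewrite subr_gt0.
have d1 : is_derive l 1 (fun l : R => l `^ A) (A * l `^ (A - 1)).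
  exact: is_derive1_powR.
have d2 : is_derive l 1 (fun l : R => (1 - l) `^ B) (- (B * (1 - l) `^ (B - 1))).
  have := @is_derive1_comp R (fun x : R => x `^ B) (fun l : R => 1 - l) l _ _
    (is_derive1_powR B l1') _.
  rewrite /comp => H; apply: is_derive_eq; rewrite /GRing.scale /=; ring.
have d3 : is_derive l 1 (fun l : R => (1 + w * l) `^ G)
    (G * (1 + w * l) `^ (G - 1) * w).
  have := @is_derive1_comp R (fun x : R => x `^ G) (fun l : R => 1 + w * l) l _ _
    (is_derive1_powR G wl0) _.
  rewrite /comp => H; apply: is_derive_eq; rewrite /GRing.scale /=; ring.
rewrite /bker; apply: is_derive_eq; rewrite /GRing.scale /=.
have -> : l `^ A = l * l `^ (A - 1) by rewrite -powRS// subrK.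
have -> : (1 - l) `^ B = (1 - l) * (1 - l) `^ (B - 1) by rewrite -powRS// subrK.
have -> : (1 + w * l) `^ G = (1 + w * l) * (1 + w * l) `^ (G - 1).
  by rewrite -powRS// subrK.
ring.
Qed.

Lemma continuous_bker A B G w l : 0 <= w -> 0 < l < 1 ->
  {for l, continuous (bker A B G w)}.
Proof.
move=> w0 l01; apply/differentiable_continuous/derivable1_diffP.
by have [] := is_derive_bker A B G w0 l01.
Qed.

Lemma measurable_bker A B G w : 0 <= w ->
  measurable_fun (`]0%R, 1%R[%classic : set R) (bker A B G w).
Proof.
move=> w0; apply: open_continuous_measurable_fun => //.
by move=> x; rewrite inE /= in_itv /=; exact: continuous_bker.
Qed.

(** One bound for both signs of the exponent; it serves with [y = 1 + w] for the last factor of the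
    kernel and with [y = 2] on the halves of []0, 1[]. *)
Lemma powR_le_expnorm x A y : 0 < x -> 1 <= y -> x <= y -> y^-1 <= x ->
  x `^ A <= y `^ `|A|.
Proof.
move=> x0 y1 xy yx; have y0 : 0 < y by lra.
have [A0|A0] := leP 0 A.
  by rewrite ger0_norm//; apply: ge0_ler_powR => //; rewrite nnegrE ltW.
rewrite ltr0_norm//.
have -> : x `^ A = (x `^ (- A))^-1 by rewrite -powRN opprK.
rewrite -[leRHS]invrK lef_pV2 ?posrE ?invr_gt0 ?powR_gt0//.
have <- : (y^-1) `^ (- A) = (y `^ (- A))^-1.
  by rewrite -powR_inv1 ?ltW// -powRrM mulN1r [LHS]powRN.
by apply: ge0_ler_powR => //; rewrite ?nnegrE ?invr_ge0 ?ltW// oppr_gt0.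
Qed.

Lemma powR_oneD_le A w x l : 0 <= x <= w -> 0 < l < 1 ->
  (1 + x * l) `^ A <= (1 + w) `^ `|A|.
Proof.
move=> /andP[x0 xw] /andP[l0 l1].
have xl : 0 <= x * l by rewrite mulr_ge0// ltW.
have xlw : x * l <= w by apply: le_trans xw; rewrite ler_piMr// ltW.
apply: powR_le_expnorm; try lra.
rewrite -[leRHS]invrK lef_pV2 ?posrE ?invr_gt0; [|lra|lra].
by apply: (@le_trans _ _ 1); [rewrite invf_le1|]; lra.
Qed.

(** Uniformity in [x] up to [w] makes this the domination for differentiating in the parameter. *)
Lemma bker_le A B G w x l : 0 <= x <= w -> 0 < l < 1 ->
  bker A B G x l <= (1 + w) `^ `|G| * (l `^ A * (1 - l) `^ B).
Proof.
move=> xw l01; rewrite /bker mulrC; apply: ler_wpM2r.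
  by rewrite mulr_ge0// powR_ge0.
exact: powR_oneD_le.
Qed.

(** The product is compared with the sum [f], which has the elementary antiderivative [F], bounded
    on []0, 1[]. *)
Lemma integrable_powR2 A B : -1 < A -> -1 < B ->
  mu.-integrable `]0%R, 1%R[ (EFin \o (fun l : R => l `^ A * (1 - l) `^ B)).
Proof.
move=> A1 B1.
pose f l := l `^ A + (1 - l) `^ B.
pose F l := (A + 1)^-1 * l `^ (A + 1) - (B + 1)^-1 * (1 - l) `^ (B + 1).
have A0 : 0 < A + 1 by lra.
have B0 : 0 < B + 1 by lra.
have mp (C : R) : measurable_fun (`]0%R, 1%R[%classic : set R) (fun l : R => (1 - l) `^ C).
  apply: measurable_funTS.
  apply: (@measurableT_comp _ _ _ _ _ _ (fun x : R => x `^ C) _ (fun l : R => 1 - l)).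
    exact: measurable_powR.
  exact: measurable_funB.
have mp' (C : R) : measurable_fun (`]0%R, 1%R[%classic : set R) (fun l : R => l `^ C).
  by apply: measurable_funTS; exact: measurable_powR.
have intf : mu.-integrable `]0%R, 1%R[ (EFin \o f).
  apply: (@integrable_oo01_ge0 R F f _ _ ((A + 1)^-1 + (B + 1)^-1)).
  - move=> l /andP[l0 l1].
    have l1' : 0 < 1 - l by rewrite subr_gt0.
    have d1 : is_derive l 1 (fun l : R => l `^ (A + 1)) ((A + 1) * l `^ (A + 1 - 1)).
      exact: is_derive1_powR.
    have d2 : is_derive l 1 (fun l : R => (1 - l) `^ (B + 1))
        (- ((B + 1) * (1 - l) `^ (B + 1 - 1))).
      have := @is_derive1_comp R (fun x : R => x `^ (B + 1)) (fun l : R => 1 - l) l _ _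
        (is_derive1_powR (B + 1) l1') _.
      rewrite /comp => H; apply: is_derive_eq; rewrite /GRing.scale /=; ring.
    rewrite /F /f; apply: is_derive_eq; rewrite /GRing.scale /= !addrK.
    by field; rewrite !gt_eqF.
  - move=> l l01; have /andP[l0 l1] := l01; rewrite /f.
    have c1 : {for l, continuous (fun l : R => l `^ A)}.
      apply/differentiable_continuous/derivable1_diffP.
      by apply: derivable_powR; rewrite in_itv /= l0.
    have c2 : {for l, continuous (fun l : R => (1 - l) `^ B)}.
      have -> : (fun l : R => (1 - l) `^ B) = bker 0 B 0 0.
        by apply/funext => y; rewrite /bker !powRr0 mul1r mulr1.
      exact: continuous_bker.
    exact: continuousD c1 c2.
  - by move=> l _; rewrite addr_ge0// powR_ge0.
  - move=> l /andP[l0 l1]; apply: (le_trans (ler_normB _ _)).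
    have pw C : 0 < C -> forall y, 0 < y < 1 -> `|C^-1 * y `^ C| <= C^-1.
      move=> C0 y /andP[y0 y1]; rewrite ger0_norm; last first.
        by rewrite mulr_ge0 ?powR_ge0// invr_ge0 ltW.
      rewrite ler_piMr ?invr_ge0 ?(ltW C0)//.
      rewrite -[leRHS](powRr0 y); apply: ger_powR; last exact: ltW.
      by rewrite y0 ltW.
    by apply: lerD; apply: pw => //; apply/andP; split; lra.
(* On each half of []0, 1[] the factor that is regular there is at most [2] to the absolute value of
   its exponent. *)
apply: (@integrable_dominated R _ _ mu _ _ f (2 `^ `|A| + 2 `^ `|B|)) => //.
  exact: (measurable_funM (mp' A) (mp B)).
move=> l /=; rewrite in_itv /= => /andP[l0 l1].
rewrite [leLHS]ger0_norm ?mulr_ge0 ?powR_ge0// /f.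
have a0 := powR_ge0 2 `|A|; have b0 := powR_ge0 2 `|B|.
have l2 := powR_ge0 l A; have l3 := powR_ge0 (1 - l) B.
have [lh|lh] := leP l 2^-1.
  have : (1 - l) `^ B <= 2 `^ `|B|.
    by apply: powR_le_expnorm; lra.
  by nra.
have : l `^ A <= 2 `^ `|A|.
  by apply: powR_le_expnorm; lra.
by nra.
Qed.

Lemma integrable_bker A B G w : 0 <= w -> -1 < A -> -1 < B ->
  mu.-integrable `]0%R, 1%R[ (EFin \o bker A B G w).
Proof.
move=> w0 A1 B1.
apply: (@integrable_dominated R _ _ mu _ _ (fun l => l `^ A * (1 - l) `^ B)
    ((1 + w) `^ `|G|)) => //.
- exact: measurable_bker.
- exact: integrable_powR2.
move=> l /=; rewrite in_itv /= => l01.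
rewrite ger0_norm; last by rewrite ltW// bker_gt0.
by apply: bker_le => //; rewrite w0 lexx.
Qed.

End BetaKernel.

(** * Beta integrals: recurrences and parameter derivative *)

Section BetaIntegral.
Context {R : realType}.
Implicit Types x y l w A B G h b s : R.
Local Notation mu := (@lebesgue_measure R).

(** Links the closed interval of [gb_phi] to the open one, where the kernel is smooth; the endpoints
    are a null set. *)
Lemma Rintegral_bker_cc A B G w : 0 <= w ->
  Rintegral mu `[0%R, 1%R]%classic (bker A B G w) = bint A B G w.
Proof.
move=> w0; rewrite /bint /Rintegral; congr fine.
rewrite integral_itv_bndoo//.
by apply/measurable_EFinP; exact: measurable_bker.
Qed.

(** A zero integral would make the strictly positive kernel vanish almost everywhere on an interval
    of measure [1]. *)
Lemma bint_gt0 A B G w : 0 <= w -> -1 < A -> -1 < B -> 0 < bint A B G w.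
Proof.
move=> w0 A1 B1.
have ik := integrable_bker G w0 A1 B1.
rewrite lt_neqAle; apply/andP; split; last first.
  apply: Rintegral_ge0 => l /=; rewrite in_itv /= => l01.
  by rewrite ltW// bker_gt0.
apply/negP => /eqP I0.
have : (\int[mu]_(x in `]0%R, 1%R[) `|(EFin \o bker A B G w) x| = 0)%E.
  transitivity (\int[mu]_(x in `]0%R, 1%R[) (bker A B G w x)%:E)%E.
    apply: eq_integral => l; rewrite inE /= in_itv /= => l01.
    by rewrite gtr0_norm// bker_gt0.
  rewrite -[LHS]fineK; last by apply: integrable_fin_num.
  by rewrite -/(Rintegral _ _ _) -/(bint A B G w) -I0.
have mk : measurable_fun (`]0%R, 1%R[%classic : set R) (EFin \o bker A B G w).
  by apply/measurable_EFinP; exact: measurable_bker.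
move/(@ae_eq_integral_abs _ _ _ mu _ (measurable_itv _) _ mk).
move=> [N [mN N0 sub]].
have : (mu `]0%R, 1%R[%classic <= mu N)%E.
  apply: le_measure; rewrite ?inE//.
  move=> l /= l01; apply: sub => /=; apply/not_implyP; split => //.
  move: l01; rewrite in_itv /= => l01 [] E.
  by have := bker_gt0 A B G w0 l01; rewrite E ltxx.
by rewrite lebesgue_measure_itv /= lte01 N0 oppr0 adde0 leNgt lte01.
Qed.

Lemma bintSr A B G w : 0 <= w -> -1 < A -> -1 < B ->
  bint A B (G + 1) w = bint A B G w + w * bint (A + 1) B G w.
Proof.
move=> w0 A1 B1; have A2 : -1 < A + 1 by lra.
have ik := integrable_bker G w0 A1 B1.
have ik1 := integrable_bker G w0 A2 B1.
have lin l : (`]0%R, 1%R[%classic : set R) l -> bker A B (G + 1) w l =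
    1 * bker A B G w l + w * bker (A + 1) B G w l + 0 * bker A B G w l.
  rewrite /= in_itv /= => /andP[l0 l1].
  by rewrite bkerSr// bkerSl//; ring.
rewrite /bint; have [_ ->] := Rintegral_lin3 (mu := mu) (measurable_itv _) ik ik1 ik lin.
by rewrite mul1r mul0r addr0.
Qed.

Lemma bint_lt A B G w : 0 <= w -> -1 < A -> -1 < B ->
  bint (A + 1) B G w < bint A B G w.
Proof.
move=> w0 A1 B1; have A2 : -1 < A + 1 by lra.
have B2 : -1 < B + 1 by lra.
have ik := integrable_bker G w0 A1 B1.
have ik1 := integrable_bker G w0 A2 B1.
rewrite -subr_gt0.
suff <- : bint A (B + 1) G w = bint A B G w - bint (A + 1) B G w by exact: bint_gt0.
have lin l : (`]0%R, 1%R[%classic : set R) l -> bker A (B + 1) G w l =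
    1 * bker A B G w l + (-1) * bker (A + 1) B G w l + 0 * bker A B G w l.
  rewrite /= in_itv /= => /andP[l0 l1].
  by rewrite bkerSm// bkerSl//; ring.
rewrite /bint; have [_ ->] := Rintegral_lin3 (mu := mu) (measurable_itv _) ik ik1 ik lin.
by rewrite mul1r mulN1r mul0r addr0.
Qed.

Lemma cvg_bker0 A B G w : 0 <= w -> 0 < A -> 0 <= B ->
  bker A B G w l @[l --> 0^'+] --> 0.
Proof.
move=> w0 A0 B0.
have c : (1 + w) `^ `|G| * l `^ A @[l --> (0:R)^'+] --> 0.
  by rewrite -[X in _ --> X](mulr0 ((1 + w) `^ `|G|)); apply: cvgM; [exact: cvg_cst|exact: powR_cvg0].
apply: (squeeze_cvgr _ (cvg_cst (0 : R)) c).
near=> l.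
have l01 : 0 < l < 1 by apply/andP; split; near: l; [exact: nbhs_right_gt|exact: nbhs_right_lt].
have /andP[l0 l1] := l01.
rewrite ltW ?bker_gt0//=; apply: (@le_trans _ _ _ _ _ (@bker_le R A B G w w l _ l01)).
  by rewrite w0 lexx.
apply: ler_wpM2l; first exact: powR_ge0.
rewrite ler_piMr ?powR_ge0// -[leRHS](powRr0 (1 - l)); apply: ger_powR => //.
by apply/andP; split; lra.
Unshelve. all: by end_near.
Qed.

Lemma cvg_bker1 A B G w : 0 <= w -> 0 <= A -> 0 < B ->
  bker A B G w l @[l --> 1^'-] --> 0.
Proof.
move=> w0 A0 B0.
have c1 : (1 - l) `^ B @[l --> (1:R)^'-] --> 0.
  apply/cvg_at_leftP => u [u1 ucv].
  have /cvg_at_rightP := @powR_cvg0 R _ B0.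
  move=> /(_ (fun n => 1 - u n)); apply; split => [n|]; first by rewrite subr_gt0.
  by rewrite -[X in _ --> X](subrr (1 : R)); apply: cvgB => //; exact: cvg_cst.
have c : (1 + w) `^ `|G| * (1 - l) `^ B @[l --> (1:R)^'-] --> 0.
  by rewrite -[X in _ --> X](mulr0 ((1 + w) `^ `|G|)); apply: cvgM; [exact: cvg_cst|exact: c1].
apply: (squeeze_cvgr _ (cvg_cst (0 : R)) c).
near=> l.
have l01 : 0 < l < 1 by apply/andP; split; near: l; [exact: nbhs_left_gt|exact: nbhs_left_lt].
have /andP[l0 l1] := l01.
rewrite ltW ?bker_gt0//=; apply: (@le_trans _ _ _ _ _ (@bker_le R A B G w w l _ l01)).
  by rewrite w0 lexx.
apply: ler_wpM2l; first exact: powR_ge0.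
rewrite ler_piMl ?powR_ge0// -[leRHS](powRr0 l); apply: ger_powR => //.
by rewrite l0 ltW.
Unshelve. all: by end_near.
Qed.

(** The derivative of [bker h (b + 1) (s + 1) w] integrates to [0]: as [h] and [b + 1] are positive,
    it vanishes at both ends, even when the kernels in the statement do not. *)
Lemma bint_by_parts h b s w : 0 <= w -> 0 < h -> -1 < b ->
  h * bint (h - 1) b s w + (h * (w - 1) - (b + 1) + (s + 1) * w) * bint h b s w
   = (h + b + 1 + s + 1) * w * bint (h + 1) b s w.
Proof.
move=> w0 h0 b1.
have h1 : -1 < h - 1 by lra.
have h2 : -1 < h by lra.
have h3 : -1 < h + 1 by lra.
have bp : 0 < b + 1 by lra.
pose f l := bker (h - 1) b s w l *
  (h * (1 - l) * (1 + w * l) - (b + 1) * l * (1 + w * l) + (s + 1) * w * l * (1 - l)).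
have lin l : (`]0%R, 1%R[%classic : set R) l -> f l = h * bker (h - 1) b s w l +
    (h * (w - 1) - (b + 1) + (s + 1) * w) * bker h b s w l +
    (- ((h + b + 1 + s + 1) * w)) * bker (h + 1) b s w l.
  rewrite /= in_itv /= => /andP[l0 l1].
  have E : bker h b s w l = l * bker (h - 1) b s w l by rewrite -bkerSl// subrK.
  by rewrite bkerSl// E /f; ring.
have [intf If] := Rintegral_lin3 (mu := mu) (measurable_itv _) (integrable_bker s w0 h1 b1)
  (integrable_bker s w0 h2 b1) (integrable_bker s w0 h3 b1) lin.
have dF l : 0 < l < 1 -> is_derive l 1 (bker h (b + 1) (s + 1) w) (f l).
  move=> l01; have := is_derive_bker h (b + 1) (s + 1) w0 l01.
  by rewrite !addrK.
have cf l : 0 < l < 1 -> {for l, continuous f}.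
  move=> l01; apply: continuousM; first exact: continuous_bker.
  by apply: differentiable_continuous.
have := integral_oo01_eq0 dF cf intf (cvg_bker0 _ w0 h0 (ltW bp)) (cvg_bker1 _ w0 (ltW h0) bp).
move=> /(congr1 fine); rewrite -/(Rintegral _ _ _) If /= => /eqP.
by rewrite mulNr subr_eq0 => /eqP.
Qed.

Lemma is_derive_bint A B G w : 0 < w -> -1 < A -> -1 < B ->
  is_derive w 1 (bint A B G) (G * bint (A + 1) B (G - 1) w).
Proof.
move=> w0 A1 B1.
have A2 : -1 < A + 1 by lra.
have dk x l : 0 < x -> 0 < l -> is_derive x 1 (fun x => bker A B G x l)
    (G * bker (A + 1) B (G - 1) x l).
  move=> x0 l0.
  have xl0 : 0 < 1 + x * l by rewrite ltr_wpDr// mulr_ge0// ltW.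
  have d3 : is_derive x 1 (fun x : R => (1 + x * l) `^ G)
      (G * (1 + x * l) `^ (G - 1) * l).
    have := @is_derive1_comp R (fun x : R => x `^ G) (fun x : R => 1 + x * l) x _ _
      (is_derive1_powR G xl0) _.
    rewrite /comp => H; apply: is_derive_eq; rewrite /GRing.scale /=; ring.
  rewrite /bker; apply: is_derive_eq; rewrite /GRing.scale /= powRS//.
  by ring.
have I : (`]0, 2 * w[%classic : set R) w by rewrite /= in_itv /=; apply/andP; split; lra.
have i1 x : (`]0, 2 * w[%classic : set R) x -> mu.-integrable `]0%R, 1%R[ (EFin \o bker A B G x).
  by rewrite /= in_itv /= => /andP[x0 _]; apply: integrable_bker => //; exact: ltW.
have d1 x y : (`]0, 2 * w[%classic : set R) x -> (`]0%R, 1%R[%classic : set R) y ->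
    derivable (fun x => bker A B G x y) x 1.
  rewrite /= !in_itv /= => /andP[x0 _] /andP[y0 _].
  by have [] := dk x y x0 y0.
(* Dominates the parameter derivative for all parameters in []0, 2 w[]; the extra factor [l] it
   contains is bounded by [1]. *)
pose M l := `|G| * (1 + 2 * w) `^ `|G - 1| * (l `^ A * (1 - l) `^ B).
have M0 y : 0 <= M y by rewrite /M !mulr_ge0// ?powR_ge0.
have iM : mu.-integrable `]0%R, 1%R[ (EFin \o M).
  exact: (@integrableZl _ _ _ mu _ (measurable_itv _)
    (`|G| * (1 + 2 * w) `^ `|G - 1|) _ (integrable_powR2 A1 B1)).
have M1 x y : (`]0, 2 * w[%classic : set R) x -> (`]0%R, 1%R[%classic : set R) y ->
    `|partial1of2 (bker A B G) x y| <= M y.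
  rewrite /= !in_itv /= => /andP[x0 xw] y01; have /andP[y0 y1] := y01.
  rewrite partial1of2E; have [_ ->] := dk x y x0 y0.
  rewrite normrM /M -mulrA ler_wpM2l// ger0_norm; last by rewrite ltW// bker_gt0// ltW.
  rewrite bkerSl//; apply: (@le_trans _ _ (bker A B (G - 1) x y)).
    by rewrite ler_piMl ?ltW// bker_gt0// ltW.
  by apply: bker_le => //; apply/andP; split; lra.
apply: DeriveDef.
  exact: (@derivable_under_integral R _ _ mu (bker A B G) _ (measurable_itv _)
    w 0 (2 * w) I i1 d1 M M0 iM M1).
rewrite -derive1E.
rewrite (@differentiation_under_integral R _ _ mu (bker A B G) _ (measurable_itv _)
    w 0 (2 * w) I i1 d1 M M0 iM M1).
rewrite /bint -RintegralZl//; last by apply: integrable_bker => //; exact: ltW.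
apply: eq_Rintegral => l; rewrite inE /= in_itv /= => /andP[l0 l1].
by rewrite partial1of2E; have [_ ->] := dk w l w0 l0.
Qed.

End BetaIntegral.

Lemma sub_itv01 {R : realDomainType} (u v : R) :
  0 <= u <= 1 -> 0 <= v <= 1 -> -1 <= u - v <= 1.
Proof. by move=> /andP[? ?] /andP[? ?]; apply/andP; split; lra. Qed.

(** * The ratio of beta integrals as a Riccati solution *)

Section BetaRatio.
Context {R : realType}.
Implicit Types w x : R.
Variables h q b : R.
Hypotheses (h0 : 0 < h) (q0 : 0 < q) (b1 : -1 < b).

(** This is [gb_phi] reparametrised by [p/2 + a = h - 1] and [p/2 + n/2 + e + 2 = h + q + 1]. *)
Definition bratio (w : R) : R :=
  w * bint h b (- (h + q + 1)) w / bint (h - 1) b (- (h + q + 1)) w.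

Let k := h + q + 1.
Let D w := bint (h - 1) b (- k) w.
Let N w := bint h b (- k) w.
(** Lowering the last exponent by one gives [D = A0 + w A1] and [N = A1 + w A2], with derivatives
    [- k A1] and [- k A2]. *)
Let A0 w := bint (h - 1) b (- k - 1) w.
Let A1 w := bint h b (- k - 1) w.
Let A2 w := bint (h + 1) b (- k - 1) w.

Let k0 : 0 < k. Proof. by rewrite /k !addr_gt0. Qed.
Let hm1 : -1 < h - 1. Proof. by move: h0; lra. Qed.
Let hh : -1 < h. Proof. by move: h0; lra. Qed.
Let hp1 : -1 < h + 1. Proof. by move: h0; lra. Qed.

Let D_gt0 w : 0 < w -> 0 < D w.
Proof. by move=> w0; apply: bint_gt0 => //; exact: ltW. Qed.

Let N_gt0 w : 0 < w -> 0 < N w.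
Proof. by move=> w0; apply: bint_gt0 => //; exact: ltW. Qed.

Let N_lt_D w : 0 < w -> N w < D w.
Proof.
move=> w0; rewrite /N /D -[X in bint X _ _ _ < _](subrK 1 h).
by apply: bint_lt => //; exact: ltW.
Qed.

Let A1_gt0 w : 0 < w -> 0 < A1 w.
Proof. by move=> w0; apply: bint_gt0 => //; exact: ltW. Qed.

Let A2_gt0 w : 0 < w -> 0 < A2 w.
Proof. by move=> w0; apply: bint_gt0 => //; exact: ltW. Qed.

Let A0_gt0 w : 0 < w -> 0 < A0 w.
Proof. by move=> w0; apply: bint_gt0 => //; exact: ltW. Qed.

Let DE w : 0 < w -> D w = A0 w + w * A1 w.
Proof.
move=> w0; rewrite /D -[X in bint _ _ X _](subrK 1 (- k)).
by rewrite (bintSr (- k - 1) (ltW w0) hm1 b1) [h - 1 + 1]subrK.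
Qed.

Let NE w : 0 < w -> N w = A1 w + w * A2 w.
Proof.
move=> w0; rewrite /N -[X in bint _ _ X _](subrK 1 (- k)).
by rewrite (bintSr (- k - 1) (ltW w0) hh b1).
Qed.

Let D_der w : 0 < w -> is_derive w 1 D (- k * A1 w).
Proof.
by move=> w0; have := is_derive_bint (- k) w0 hm1 b1; rewrite subrK.
Qed.

Let N_der w : 0 < w -> is_derive w 1 N (- k * A2 w).
Proof. by move=> w0; have := is_derive_bint (- k) w0 hh b1. Qed.

(** Integration by parts at exponent [- k - 1] closes the system: [A1], then [A2], and so both
    derivatives, are expressed through [D] and [N] alone. *)
Let A1E w : 0 < w -> k * (w + 1) * A1 w = h * D w + (q - b) * N w.
Proof.
move=> w0; rewrite DE// NE//.
have := bint_by_parts (- k - 1) (ltW w0) h0 b1.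
rewrite -/(A0 w) -/(A1 w) -/(A2 w) subrK /k => E.
have {}E : (q - b) * w * A2 w = - (h * A0 w + (h * (w - 1) - (b + 1) + - (h + q + 1) * w) * A1 w).
  by rewrite E; ring.
have -> : (q - b) * (A1 w + w * A2 w) = (q - b) * A1 w + (q - b) * w * A2 w by ring.
by rewrite E; ring.
Qed.

Lemma bratio_gt0 w : 0 < w -> 0 < bratio w.
Proof.
move=> w0; rewrite /bratio divr_gt0//; last exact: D_gt0.
by rewrite mulr_gt0//; exact: N_gt0.
Qed.

Lemma bratio_lt w : 0 < w -> bratio w < w.
Proof.
move=> w0; rewrite /bratio ltr_pdivrMr; last exact: D_gt0.
by rewrite ltr_pM2l//; exact: N_lt_D.
Qed.

Lemma bratio_der w : 0 < w ->
  is_derive w 1 bratio (bratio w * logslope h q b bratio w / w).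
Proof.
move=> w0; have dD := D_der w0; have dN := N_der w0.
have Dp := D_gt0 w0; have Np := N_gt0 w0.
have Dn0 : D w != 0 by apply: lt0r_neq0; exact: Dp.
have dV : is_derive w 1 (fun w => (D w)^-1) (- (D w) ^- 2 *: (- k * A1 w)).
  exact: is_deriveV.
have -> : bratio = (fun w => w * N w * (D w)^-1) by [].
have kn0 : k != 0 by rewrite gt_eqF.
have a1 : A1 w = (h * D w + (q - b) * N w) / (k * (w + 1)).
  rewrite -A1E//; field; rewrite kn0 /=; lra.
have a2 : A2 w = (N w - A1 w) / w.
  by rewrite NE//; field; lra.
apply: is_derive_eq; rewrite /GRing.scale /= a2 a1 /logslope.
have Nn0 : N w != 0 by rewrite gt_eqF.
rewrite /k; field.
rewrite Nn0 Dn0 -/k kn0 /=; do ?(apply/andP; split => //); lra.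
Qed.

(** Integration by parts at exponent [- k] itself, [E2] being the integral with one more factor [l].
    Both upper bounds on [bratio] below are read off it. *)
Let moment2 w : 0 < w -> exists2 E2, 0 < E2 < N w &
  h * D w = (h + b + 1 + q * w) * N w + (b + 1 - q) * w * E2.
Proof.
move=> w0; exists (bint (h + 1) b (- k) w).
  apply/andP; split; first by apply: bint_gt0 => //; exact: ltW.
  by apply: bint_lt => //; exact: ltW.
have := bint_by_parts (- k) (ltW w0) h0 b1.
rewrite -/(D w) -/(N w) /k => E.
apply/eqP; rewrite -subr_eq; apply/eqP.
have -> : (b + 1 - q) * w = (h + b + 1 + - (h + q + 1) + 1) * w by ring.
by rewrite -E; ring.
Qed.

(** By [moment2], [h D - (h + 1 + b) N = w (q (N - E2) + (b + 1) E2)], a sum of nonnegative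
    terms. *)
Lemma bratio_ub0 w : 0 < w -> (h + 1 + b) * bratio w <= h * w.
Proof.
move=> w0; have [E2 /andP[E20 E2N] E] := moment2 w0.
have Dp := D_gt0 w0.
rewrite /bratio -/k -/(D w) -/(N w) mulrA ler_pdivrMr//.
rewrite [_ * (w * _)]mulrCA [h * w]mulrC -[leRHS]mulrA ler_pM2l// E.
have : 0 <= w * (q * (N w - E2)).
  by apply: mulr_ge0; [lra|apply: mulr_ge0; move: q0; lra].
have : 0 <= w * ((b + 1) * E2).
  by apply: mulr_ge0; [lra|apply: mulr_ge0; move: b1; lra].
by lra.
Qed.

Lemma bratio_ub w : 0 < w -> q <= b + 1 -> q * bratio w <= h.
Proof.
move=> w0 qb; have [E2 /andP[E20 E2N] E] := moment2 w0.
have Dp := D_gt0 w0.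
rewrite /bratio -/k -/(D w) -/(N w) mulrA ler_pdivrMr// E.
have : 0 <= (b + 1 - q) * w * E2.
  by apply: mulr_ge0; [apply: mulr_ge0; lra|lra].
have : 0 <= (h + b + 1) * N w.
  by apply: mulr_ge0; [move: b1 h0; lra|lra].
by lra.
Qed.

(** [L - 1] is [k] times a difference of two fractions, [w A1 / D] and [w A2 / N], each in [[0, 1]]
    because [D = A0 + w A1] and [N = A1 + w A2] have positive summands. *)
Lemma logslope_bratio_bound w : 0 < w ->
  `|logslope h q b bratio w - 1| <= h + q + 1.
Proof.
move=> w0; have Dp := D_gt0 w0; have Np := N_gt0 w0.
have kn0 : k != 0 by rewrite gt_eqF.
have a1 : A1 w = (h * D w + (q - b) * N w) / (k * (w + 1)).
  rewrite -A1E//; field; rewrite kn0 /=; lra.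
have a2 : A2 w = (N w - A1 w) / w.
  by rewrite NE//; field; lra.
have Nn0 : N w != 0 by rewrite gt_eqF.
have Dn0 : D w != 0 by apply: lt0r_neq0; exact: Dp.
have -> : logslope h q b bratio w - 1 = k * (w * A1 w / D w - w * A2 w / N w).
  rewrite a2 a1 /logslope /bratio -/k -/(D w) -/(N w) /k; field.
  rewrite Nn0 Dn0 -/k kn0 /=; do ?(apply/andP; split => //); lra.
have frac x y : 0 < x -> 0 < y -> 0 <= y / (x + y) <= 1.
  move=> x0 y0; apply/andP; split; first by apply: divr_ge0; lra.
  by rewrite ler_pdivrMr; lra.
have u1 : 0 <= w * A1 w / D w <= 1.
  by rewrite DE//; apply: frac (A0_gt0 w0) (mulr_gt0 w0 (A1_gt0 w0)).
have u2 : 0 <= w * A2 w / N w <= 1.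
  by rewrite NE//; apply: frac (A1_gt0 w0) (mulr_gt0 w0 (A2_gt0 w0)).
rewrite normrM (gtr0_norm k0) -/k ler_piMr ?(ltW k0)// ler_norml.
exact: sub_itv01 u1 u2.
Qed.

End BetaRatio.

(** * Sign of the risk integrand *)

Section RiskIntegrand.
Context {R : realType}.
Implicit Types w : R.
Variables h q b P n : R.
Hypotheses (h0 : 0 < h) (q0 : 0 < q) (b1 : -1 < b) (P2 : 2 < P) (n0 : 0 <= n).
Local Notation phi := (bratio h q b).
Local Notation L := (logslope h q b phi).

Let phi_gt0 w : 0 < w -> 0 < phi w. Proof. exact: bratio_gt0. Qed.
Let phi_lt w : 0 < w -> phi w < w. Proof. exact: bratio_lt. Qed.
Let phi_der w : 0 < w -> is_derive w 1 phi (phi w * L w / w).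
Proof. exact: bratio_der. Qed.
Let phi_ub0 w : 0 < w -> (h + 1 + b) * phi w <= h * w.
Proof. exact: bratio_ub0. Qed.

(** The constant [C] is there for integrability: it bounds [phi^2 / w], to which Stein's identity is
    applied in the [Z] block. *)
Definition good_shrinkage : Prop := exists C : R, forall w, 0 < w ->
  phi w <= C /\ 0 <= 2 * (P - 2) - (n + 2) * phi w + 4 * ((1 + phi w) * L w).

Lemma good_shrinkage_of_ge : (n + 2) * h <= 2 * (P - 2) * q ->
  q - 1 <= b \/ 0 <= b -> good_shrinkage.
Proof.
move=> hq hb; exists (h / q) => w w0.
have p0 : 0 < phi w by exact: bratio_gt0.
have [pq L0] : q * phi w <= h /\ 0 <= L w.
  have [b0|b0] := leP 0 b.
    split.
      exact: (phi_le_of_ge0 h0 q0 b1 phi_gt0 phi_lt phi_der b0 w0).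
    exact: (logslope_ge0_of_ge0 h0 q0 b1 phi_gt0 phi_lt phi_der phi_ub0 b0 w0).
  have pq : q * phi w <= h.
    by apply: bratio_ub => //; case: hb => ?; lra.
  split=> //.
  exact: (logslope_ge0_of_neg h0 q0 b1 phi_gt0 phi_lt w0 (ltW b0) pq).
split; first by rewrite ler_pdivlMr// mulrC.
apply: addr_ge0; last first.
  by apply: mulr_ge0 => //; apply: mulr_ge0 => //; lra.
rewrite subr_ge0 -(ler_pM2l q0).
have : (n + 2) * (q * phi w) <= (n + 2) * h by rewrite ler_wpM2l//; move: n0; lra.
by lra.
Qed.

Lemma good_shrinkage_of_neg (beta : R) : b = - beta -> 0 < beta ->
  beta * (q + h) * (2 * P + 4 * h) <= 2 * (P - 2) * q - (n + 2) * h ->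
  good_shrinkage.
Proof.
move=> bE beta0 H.
(* The hypothesis implies [beta (q + h) (2 P + 4 h) < q (2 P + 4 h)], as [2 (P - 2) q] is below the
   right side. *)
have D0 : 0 < q - beta * (q + h).
  have P0 : 0 < 2 * P + 4 * h by move: h0 P2; lra.
  rewrite subr_gt0 -(ltr_pM2r P0).
  have : 0 <= (n + 2) * h by apply: mulr_ge0; move: h0 n0; lra.
  have : 0 < q * h by exact: mulr_gt0.
  by move: q0; lra.
exists (h / (q - beta * (q + h))) => w w0.
have pD : (q - beta * (q + h)) * phi w <= h.
  exact: (phi_le_of_neg h0 q0 b1 phi_gt0 phi_lt phi_der phi_ub0 bE beta0 D0 w0).
split; first by rewrite ler_pdivlMr// mulrC.
have lo : - (beta * (q + h) * (1 + h)) <=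
    (q - beta * (q + h)) * ((1 + phi w) * L w).
  exact: (logslope_lower h0 q0 b1 phi_gt0 phi_lt phi_der phi_ub0 bE beta0 D0 w0).
(* After multiplication by [D] the two bounds leave [2 (P - 2) D - (n + 2) h - 4 beta (q + h) (1 +
   h)]. The coefficients [2 (P - 2)] and [4 (1 + h)] of [beta (q + h)] add up to the [2 P + 4 h] of
   the hypothesis. *)
rewrite -(pmulr_rge0 _ D0).
have : (n + 2) * ((q - beta * (q + h)) * phi w) <= (n + 2) * h.
  by rewrite ler_wpM2l//; move: n0; lra.
move: ((1 + phi w) * L w) lo => V lo.
by lra.
Qed.

End RiskIntegrand.

(** * Dilations and the coordinate spaces behind [iter_int] *)

Section Scaling.
Context {R : realType}.
Local Notation mu := (@lebesgue_measure R).

Lemma measurable_scaler (r : R) :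
  measurable_fun [set: measurableTypeR R] (fun x : measurableTypeR R => r * x : measurableTypeR R).
Proof. by apply: measurable_funM. Qed.

(** [r] times the image of Lebesgue measure under [x -> r x] gives each []a, b]] its length, so it
    is Lebesgue measure by uniqueness. *)
Lemma lebesgue_integral_scaler (r : R) (F : measurableTypeR R -> \bar R) : 0 < r ->
  measurable_fun setT F -> (forall x, (0 <= F x)%E) ->
  (r%:E * \int[mu]_x F (r * x)%R = \int[mu]_x F x)%E.
Proof.
move=> r0 mF F0.
have rn : 0 <= r by exact: ltW.
pose push : {measure set (measurableTypeR R) -> \bar R} :=
  measure_function_pushforward__canonical__measure_function_Measure mu (measurable_scaler r).
pose nu : {measure set (measurableTypeR R) -> \bar R} := mscale (NngNum rn) push.
have E A : measurable A -> mu A = nu A.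
  apply: lebesgue_measure_unique => X [[a b] _ <-] /=.
  rewrite /nu /push /= /mscale /= /pushforward.
  have -> : (fun x : R => r * x) @^-1` `]a, b]%classic = `](a / r), (b / r)]%classic.
    apply/seteqP; split => x; rewrite /= !in_itv /= ltr_pdivrMr// ler_pdivlMr//.
      by rewrite ![r * _]mulrC.
    by rewrite ![r * _]mulrC.
  rewrite !lebesgue_measure_itv /= !lte_fin ltr_pM2r ?invr_gt0//.
  case: ifPn => _; last by rewrite mule0.
  by rewrite -!EFinB -EFinM; congr EFin; field; rewrite gt_eqF.
rewrite [RHS](@eq_measure_integral _ _ _ setT nu); last by move=> A mA _; exact: E.
rewrite /nu ge0_integral_mscale//=.
by rewrite ge0_integral_pushforward//; exact: measurable_scaler.
Qed.

End Scaling.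

Section SigmaFiniteProduct.
Context {R : realType} (d1 d2 : measure_display).
Context (T1 : measurableType d1) (T2 : measurableType d2).
Variables (m1 : {sigma_finite_measure set T1 -> \bar R}).
Variables (m2 : {sigma_finite_measure set T2 -> \bar R}).

Lemma product_measure1_sigma_finite : sigma_finite setT (m1 \x m2)%E.
Proof.
have [F FT Foo] := sigma_finiteT m1; have [G GT Goo] := sigma_finiteT m2.
pose H n := if @unpickle (nat * nat)%type n is Some ij then F ij.1 `*` G ij.2 else set0.
exists H => [|n].
  apply/seteqP; split => // -[x y] _.
  have [i _ Fx] : (\bigcup_i F i) x by rewrite -FT.
  have [j _ Gy] : (\bigcup_i G i) y by rewrite -GT.
  by exists (pickle (i, j)) => //; rewrite /H pickleK.
rewrite /H; case: unpickle => [[i j]|] /=; last by rewrite measure0.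
have [mF Fy] := Foo i; have [mG Gy] := Goo j.
split; first exact: measurableX.
by rewrite product_measure1E// lte_mul_pinfty// ge0_fin_numE.
Qed.

(* The library's sigma-finite instance on [m1 \x m2] is shadowed by the one for
   subprobabilities, hence this explicit packing. *)
Definition sigma_finite_product : {sigma_finite_measure set (T1 * T2)%type -> \bar R} :=
  HB.pack (m1 \x m2)%E (Measure_isSigmaFinite.Build _ _ _ (m1 \x m2)%E
    product_measure1_sigma_finite).

End SigmaFiniteProduct.

Section CoordinateSpace.
Context {R : realType}.
Local Notation mu := (@lebesgue_measure R).

(* [co] reads a point of an abstract measure space as the vector [v 0, .., v (k-1)]
   consumed by [iter_int], and [sc r] is the dilation by [r] on that space. *)
Lemma coord_space (k : nat) : exists (d : measure_display) (T : measurableType d)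
  (m : {sigma_finite_measure set T -> \bar R}) (co : T -> nat -> R) (sc : R -> T -> T),
  [/\ (forall i, measurable_fun setT (fun t => co t i)),
      (forall F : (nat -> R) -> \bar R, (forall v, (0 <= F v)%E) ->
        measurable_fun setT (F \o co) -> iter_int k F = (\int[m]_t F (co t))%E),
      (forall r t i, co (sc r t) i = r * co t i),
      (forall r, measurable_fun setT (sc r)) &
      (forall (r : R) (F : T -> \bar R), 0 < r -> (forall t, (0 <= F t)%E) ->
        measurable_fun setT F ->
        ((r ^+ k)%:E * \int[m]_t F (sc r t) = \int[m]_t F t)%E)].
Proof.
elim: k => [|k [d [T [m [co [sc [mco iterE coE msc intsc]]]]]]].
  (* A point of mass [1] read as the zero vector, at which [iter_int 0] evaluates. *)
  exists _, unit, (dirac tt : {sigma_finite_measure set _ -> \bar R}),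
    (fun _ _ => 0), (fun _ t => t); split => //.
  - move=> F F0 mF; rewrite integral_dirac//= diracT mul1e //.
  - by move=> r t i; rewrite mulr0.
  - by move=> r F r0 F0 mF; rewrite mul1e.
pose M : {sigma_finite_measure set (T * measurableTypeR R)%type -> \bar R} :=
  sigma_finite_product m mu.
exists _, (T * measurableTypeR R)%type, M,
  (fun t => upd (co t.1) k t.2), (fun r t => (sc r t.1, r * t.2)).
have mco' i : measurable_fun setT (fun t : (T * measurableTypeR R)%type => upd (co t.1) k t.2 i).
  rewrite /upd; case: eqP => _; first exact: measurable_snd.
  by apply: (measurableT_comp (mco i)); exact: measurable_fst.
have msc' r : measurable_fun setT (fun t : (T * measurableTypeR R)%type =>
    (sc r t.1, r * t.2) : (T * measurableTypeR R)%type).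
  apply: measurable_fun_pair.
    by apply: (measurableT_comp (msc r)); exact: measurable_fst.
  by apply: (measurableT_comp (measurable_scaler r)); exact: measurable_snd.
split => //.
- move=> F F0 mF /=.
  (* [iter_int] integrates the highest index outermost. That coordinate is the second factor of the
     product, which explains this order in Tonelli. *)
  rewrite fubini_tonelli2//; apply: eq_integral => x _.
  rewrite iterE//; apply: (@measurableT_comp _ _ _ _ _ _
    (F \o (fun t : (T * measurableTypeR R)%type => upd (co t.1) k t.2)) _
    (fun t : T => (t, x) : (T * measurableTypeR R)%type)) => //.
- by move=> r [t x] i /=; rewrite /upd; case: eqP => _.
- move=> r F r0 F0 mF.
  rewrite fubini_tonelli2//; last exact: (measurableT_comp mF).
  rewrite fubini_tonelli2// /fubini_G /=.
  rewrite -[RHS](lebesgue_integral_scaler r0); last 2 first.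
  + exact: (measurable_fun_fubini_tonelli_G (m1 := m) F mF F0).
  + by move=> x; apply: integral_ge0.
  rewrite exprS EFinM -muleA; congr (_ * _)%E.
  rewrite -ge0_integralZl//.
  + apply: eq_integral => x _; rewrite (intsc r (fun t => F (t, r * x)))//.
    apply: (@measurableT_comp _ _ _ _ _ _ F _
      (fun t : T => (t, r * x) : (T * measurableTypeR R)%type)) => //.
  + apply: (measurable_fun_fubini_tonelli_G (m1 := m) (fun t => F (sc r t.1, r * t.2))) => //.
    exact: (@measurableT_comp _ _ _ _ _ _ F _ _ mF (msc' r)).
  + by move=> x _; apply: integral_ge0.
  + by rewrite lee_fin exprn_ge0// ltW.
Qed.

End CoordinateSpace.

(** * Gaussian densities and their domination *)

Section GaussianDensity.
Context {R : realType}.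
Implicit Types (v theta : nat -> R) (s sigma c x : R) (k : nat).
Local Notation mu := (@lebesgue_measure R).

Lemma upd_eq v k x : upd v k x k = x.
Proof. by rewrite /upd eqxx. Qed.

Lemma upd_lt v k x (i : 'I_k) : upd v k x i = v i.
Proof. by rewrite /upd ltn_eqF. Qed.

(** The constant [c] is general so that the induction can absorb into it the factor of the outermost
    coordinate. *)
Lemma iter_int_prod k c (f : nat -> R -> R) :
  (forall i, mu.-integrable setT (EFin \o f i)) ->
  iter_int k (fun v => (c * \prod_(i < k) f i (v i))%:E) =
  (c * \prod_(i < k) Rintegral mu setT (f i))%:E.
Proof.
move=> intf; elim: k c => [|k IH] c; first by rewrite /= !big_ord0.
rewrite /=; under eq_integral => x _.
  rewrite (_ : (fun v => _) = (fun v => (c * f k x * \prod_(i < k) f i (v i))%:E)).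
    rewrite IH; over.
  apply/funext => v; rewrite big_ord_recr /= upd_eq; congr EFin.
  rewrite [X in _ * (X * _)](eq_bigr (fun i : 'I_k => f i (v i))); first by ring.
  by move=> i _; rewrite upd_lt.
rewrite big_ord_recr /=.
under eq_integral do rewrite mulrAC EFinM.
rewrite integralZl//; last exact: intf.
rewrite -[X in (_ * X)%E]fineK; last by apply: integrable_fin_num => //; exact: intf.
by rewrite -EFinM mulrA.
Qed.

(** The unnormalised centred Gaussian with standard deviation [4 sigma], wide enough to dominate the
    density, dilated by any [s >= 1/2], times [1 + |v|^2]. *)
Definition wgauss k sigma v : R := expR (- (sqnorm k v / (32 * sigma ^+ 2))).

Lemma wgaussE k sigma v :
  wgauss k sigma v = \prod_(i < k) expR (- (v i ^+ 2 / (32 * sigma ^+ 2))).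
Proof. by rewrite /wgauss /sqnorm mulr_suml -sumrN expR_sum. Qed.

Lemma integrable_wgauss1 sigma : 0 < sigma ->
  mu.-integrable setT (EFin \o (fun x : R => expR (- (x ^+ 2 / (32 * sigma ^+ 2))))).
Proof.
move=> s0.
have s4 : 4 * sigma != 0 by rewrite mulf_neq0// gt_eqF.
have pk : 0 < normal_peak (4 * sigma) by exact: normal_peak_gt0.
have := @integrableZl _ _ _ mu setT measurableT (normal_peak (4 * sigma))^-1 _
  (integrable_normal_pdf 0 (4 * sigma)).
apply: eq_integrable => // x _ /=.
rewrite normal_pdfE// -EFinM mulrA mulVf ?gt_eqF// mul1r /normal_fun subr0.
by congr (expR _)%:E; field; rewrite gt_eqF.
Qed.

Definition gdens k theta sigma v : R := \prod_(i < k) gauss (theta i) sigma (v i).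

Definition dotp k v theta : R := \sum_(i < k) v i * theta i.

Definition gconst k sigma : R := ((Num.sqrt (2 * pi) * sigma)^-1) ^+ k.

Lemma gdens_scale k theta sigma v s : gdens k theta sigma (fun i => s * v i) =
  gconst k sigma * expR (- ((s ^+ 2 * sqnorm k v - 2 * s * dotp k v theta +
    sqnorm k theta) / (2 * sigma ^+ 2))).
Proof.
rewrite /gdens /gauss big_split /= prodr_const card_ord -/(gconst k sigma).
rewrite -expR_sum; congr (_ * expR _).
rewrite -mulr_suml -mulNr; congr (_ / _).
rewrite /sqnorm /dotp !mulr_sumr -sumrB -big_split /= -sumrN.
by apply: eq_bigr => i _; ring.
Qed.

Lemma gdensE k theta sigma v : gdens k theta sigma v =
  gconst k sigma * expR (- ((sqnorm k v - 2 * dotp k v theta +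
    sqnorm k theta) / (2 * sigma ^+ 2))).
Proof.
have := gdens_scale k theta sigma v 1.
rewrite expr1n mul1r mulr1 => <-; congr gdens.
by apply/funext => i; rewrite mul1r.
Qed.

Lemma gconst_ge0 k sigma : 0 < sigma -> 0 <= gconst k sigma.
Proof. by move=> s0; rewrite exprn_ge0// invr_ge0 mulr_ge0// ltW. Qed.

Lemma sqnorm_ge0 k v : 0 <= sqnorm k v.
Proof. by apply: sumr_ge0 => i _; exact: sqr_ge0. Qed.

(** From [(s v - 2 theta)^2 >= 0] coordinatewise; the weights leave half of [s^2 |v|^2] as decay in
    the exponent. *)
Lemma dotp_le k v theta s :
  2 * s * dotp k v theta <= s ^+ 2 * sqnorm k v / 2 + 2 * sqnorm k theta.
Proof.
rewrite /dotp /sqnorm !mulr_sumr mulr_suml -big_split /=.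
apply: ler_sum => i _; rewrite -subr_ge0.
have -> : s ^+ 2 * v i ^+ 2 / 2 + 2 * theta i ^+ 2 - 2 * s * (v i * theta i) =
  (s * v i - 2 * theta i) ^+ 2 / 2 by field.
by rewrite divr_ge0// sqr_ge0.
Qed.

Lemma dotp_norm k v theta : `|dotp k v theta| <= sqnorm k v + sqnorm k theta.
Proof.
apply: (le_trans (ler_norm_sum _ _ _)).
rewrite /sqnorm -big_split /=; apply: ler_sum => i _.
rewrite normrM -[v i ^+ 2]real_normK ?num_real// -[theta i ^+ 2]real_normK ?num_real//.
move: (`|v i|) (`|theta i|) (normr_ge0 (v i)) (normr_ge0 (theta i)) => x y x0 y0.
have := sqr_ge0 (x - y); have : 0 <= x * y by exact: mulr_ge0.
by rewrite sqrrB; lra.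
Qed.

Lemma gdens_ge0 k theta sigma v : 0 < sigma -> 0 <= gdens k theta sigma v.
Proof. by move=> s0; rewrite gdensE mulr_ge0 ?gconst_ge0// expR_ge0. Qed.

(* For [s >= 1/2] we have [|s v - theta|^2 >= |v|^2 / 8 - |theta|^2]; half of the
   resulting Gaussian decay absorbs the factor [1 + |v|^2]. *)
Lemma gdens_scale_bound k theta sigma : 0 < sigma ->
  exists2 C : R, 0 <= C & forall s v, 2^-1 <= s ->
    gdens k theta sigma (fun i => s * v i) * (1 + sqnorm k v) <=
    C * wgauss k sigma v.
Proof.
move=> s0; have sg : 0 < sigma ^+ 2 by rewrite exprn_gt0.
exists (gconst k sigma * expR (sqnorm k theta / (2 * sigma ^+ 2)) * (1 + 32 * sigma ^+ 2)).
  rewrite !mulr_ge0 ?gconst_ge0 ?expR_ge0//.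
  by rewrite addr_ge0// mulr_ge0// ltW.
move=> s v sh; rewrite gdens_scale.
set r := sqnorm k v; have r0 : 0 <= r by exact: sqnorm_ge0.
set q := sqnorm k theta.
have e1 : - ((s ^+ 2 * r - 2 * s * dotp k v theta + q) / (2 * sigma ^+ 2)) <=
    q / (2 * sigma ^+ 2) - r / (16 * sigma ^+ 2).
  have -> : q / (2 * sigma ^+ 2) - r / (16 * sigma ^+ 2) =
    (q - r / 8) / (2 * sigma ^+ 2) by field; rewrite gt_eqF.
  rewrite -mulNr ler_pM2r ?invr_gt0 ?mulr_gt0//.
  have := dotp_le k v theta s; rewrite -/r -/q.
  have : 4^-1 * r <= s ^+ 2 * r.
    apply: ler_wpM2r => //.
    have : 0 <= (s - 2^-1) * (s + 2^-1) by apply: mulr_ge0; lra.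
    by lra.
  by lra.
have e2 : 1 + r <= (1 + 32 * sigma ^+ 2) * expR (r / (32 * sigma ^+ 2)).
  have e3 := expR_ge1Dx (r / (32 * sigma ^+ 2)).
  apply: le_trans (_ : _ <= (1 + 32 * sigma ^+ 2) * (1 + r / (32 * sigma ^+ 2))) _.
    have -> : (1 + 32 * sigma ^+ 2) * (1 + r / (32 * sigma ^+ 2)) =
      1 + 32 * sigma ^+ 2 + r / (32 * sigma ^+ 2) + r by field; rewrite gt_eqF.
    have : 0 <= r / (32 * sigma ^+ 2) by rewrite divr_ge0// mulr_ge0// ltW.
    by lra.
  by rewrite ler_wpM2l//; lra.
have := sqnorm_ge0 k v; rewrite -/r => _.
apply: (@le_trans _ _ (gconst k sigma * expR (q / (2 * sigma ^+ 2) - r / (16 * sigma ^+ 2)) *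
   ((1 + 32 * sigma ^+ 2) * expR (r / (32 * sigma ^+ 2))))).
  apply: ler_pM => //.
  - by rewrite mulr_ge0 ?gconst_ge0 ?expR_ge0.
  - by rewrite addr_ge0.
  - by apply: ler_wpM2l; [exact: gconst_ge0|rewrite ler_expR].
rewrite expRD /wgauss -/r.
have -> : expR (- (r / (32 * sigma ^+ 2))) =
  expR (- (r / (16 * sigma ^+ 2))) * expR (r / (32 * sigma ^+ 2)).
  by rewrite -expRD; congr expR; field; rewrite gt_eqF.
rewrite le_eqVlt; apply/orP; left; apply/eqP; ring.
Qed.

Section Measurability.
Context (d : measure_display) (T : measurableType d) (co : T -> nat -> R).
Hypothesis mco : forall i, measurable_fun setT (fun t => co t i).

Lemma measurable_sqnorm k : measurable_fun setT (fun t => sqnorm k (co t)).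
Proof.
by apply: measurable_sum => i; apply: measurable_funX; exact: mco.
Qed.

Lemma measurable_dotp k theta : measurable_fun setT (fun t => dotp k (co t) theta).
Proof.
by apply: measurable_sum => i; apply: measurable_funM => //; exact: mco.
Qed.

Lemma measurable_gdens k theta sigma :
  measurable_fun setT (fun t => gdens k theta sigma (co t)).
Proof.
under eq_fun do rewrite gdensE.
apply: measurable_funM => //; apply: (measurableT_comp (@measurable_expR R)).
apply: measurableT_comp => //; apply: measurable_funM => //.
apply: measurable_funD => //; apply: measurable_funB; first exact: measurable_sqnorm.
by apply: measurable_funM => //; exact: measurable_dotp.
Qed.

Lemma measurable_wgauss k sigma :
  measurable_fun setT (fun t => wgauss k sigma (co t)).
Proof.
apply: (measurableT_comp (@measurable_expR R)).
apply: measurableT_comp => //; apply: measurable_funM => //.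
exact: measurable_sqnorm.
Qed.

End Measurability.

End GaussianDensity.

(** * Stein's identity by dilation *)

Section SteinDilation.
Context {R : realType} (k : nat) (d : measure_display) (T : measurableType d).
Implicit Types (s : R) (t : T).
Variables (m : {sigma_finite_measure set T -> \bar R}).
Variables (co : T -> nat -> R) (sc : R -> T -> T).
Hypothesis mco : forall i, measurable_fun setT (fun t => co t i).
Hypothesis iterE : forall F : (nat -> R) -> \bar R, (forall v, (0 <= F v)%E) ->
  measurable_fun setT (F \o co) -> iter_int k F = (\int[m]_t F (co t))%E.

Lemma integrable_wgauss (sigma : R) : 0 < sigma ->
  m.-integrable setT (EFin \o (fun t => wgauss k sigma (co t))).
Proof.
move=> s0; have mw := measurable_wgauss mco k sigma.
apply/integrableP; split; first exact/measurable_EFinP.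
have -> : (\int[m]_x `|(EFin \o (fun t => wgauss k sigma (co t))) x| =
    \int[m]_x (fun v => (wgauss k sigma v)%:E) (co x))%E.
  by apply: eq_integral => t _ /=; rewrite ger0_norm// expR_ge0.
rewrite -(iterE (F := fun v => (wgauss k sigma v)%:E)); last 2 first.
- by move=> v; rewrite lee_fin expR_ge0.
- exact/measurable_EFinP.
have -> : (fun v => (wgauss k sigma v)%:E) = (fun v : nat -> R => (1 *
    \prod_(i < k) expR (- (v i ^+ 2 / (32 * sigma ^+ 2))))%:E).
  by apply/funext => v; rewrite wgaussE mul1r.
rewrite (@iter_int_prod R k 1 (fun _ x => expR (- (x ^+ 2 / (32 * sigma ^+ 2))))).
  by rewrite ltry.
by move=> _; exact: integrable_wgauss1.
Qed.

Hypothesis coE : forall r t i, co (sc r t) i = r * co t i.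
Hypothesis msc : forall r, measurable_fun setT (sc r).
Hypothesis intsc : forall (r : R) (F : T -> \bar R), 0 < r ->
  (forall t, (0 <= F t)%E) -> measurable_fun setT F ->
  ((r ^+ k)%:E * \int[m]_t F (sc r t) = \int[m]_t F t)%E.

Variables (theta : nat -> R) (sigma : R) (G dG : R -> R) (B : R).
Hypotheses (sigma0 : 0 < sigma) (mG : measurable_fun setT G) (mdG : measurable_fun setT dG).
Hypothesis G_ge0 : forall r, 0 <= G r.
Hypothesis G_le : forall r, G r <= B.
Hypothesis dG_le : forall r, `|dG r| <= B.
Hypothesis dG0 : dG 0 = 0.
Hypothesis G_der : forall r : R, 0 < r -> is_derive r 1 G (dG r / r).

Let r t := sqnorm k (co t).
Let p t := dotp k (co t) theta.
Let q := sqnorm k theta.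
Let dens s t := gdens k theta sigma (fun i => s * co t i).
Let f s t := s ^+ k * dens s t * G (s ^+ 2 * r t).
(** The factor multiplying [s ^+ k * dens s t] in the [s]-derivative of [f]; [dG r] stands for
    [r G'(r)]. *)
Let H s t := (k%:R / s - (s * r t - p t) / sigma ^+ 2) * G (s ^+ 2 * r t) +
  2 * dG (s ^+ 2 * r t) / s.

Let f_der s t : 0 < s -> is_derive s 1 (fun s => f s t) (s ^+ k * dens s t * H s t).
Proof.
move=> s0.
have sn0 : s != 0 by rewrite gt_eqF.
have sg : sigma != 0 by rewrite gt_eqF.
have dX n : is_derive s 1 (fun s : R => s ^+ n) (n%:R * s ^+ n.-1).
  apply: DeriveDef; first exact: exprn_derivable.
  by rewrite exp_derive /GRing.scale /= mulr1.
have d1 : is_derive s 1 (fun s : R => s ^+ k) (k%:R / s * s ^+ k).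
  apply: is_derive_eq; case: k => [|j]; first by rewrite !mul0r.
  by rewrite /= [in RHS]exprS; field.
have dX2 := dX 2%N.
have d2 : is_derive s 1 (fun s => dens s t) (dens s t * (- (s * r t - p t) / sigma ^+ 2)).
  rewrite /dens; under eq_fun do rewrite gdens_scale -/(r t) -/(p t) -/q.
  rewrite gdens_scale -/(r t) -/(p t) -/q.
  have dq : is_derive s 1 (fun s => - ((s ^+ 2 * r t - 2 * s * p t + q) / (2 * sigma ^+ 2)))
     (- (s * r t - p t) / sigma ^+ 2).
    apply: is_derive_eq; rewrite /GRing.scale /=.
    by field; rewrite sg.
  have de := @is_derive1_comp R expR _ s _ _ (is_derive_expR _) dq.
  rewrite /comp in de.
  by apply: is_derive_eq; rewrite /GRing.scale /=; ring.
have d3 : is_derive s 1 (fun s => G (s ^+ 2 * r t)) (2 * dG (s ^+ 2 * r t) / s).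
  have : 0 <= r t by exact: sqnorm_ge0.
  (* At the origin the function of [s] is constant; [dG 0 = 0] makes the formula right there
     although [G] need not be differentiable at [0]. *)
  rewrite le_eqVlt => /orP[/eqP <-|r0].
    under eq_fun do rewrite mulr0.
    by rewrite mulr0 dG0 mulr0 mul0r; apply: is_derive_cst.
  have sr0 : 0 < s ^+ 2 * r t by rewrite mulr_gt0// exprn_gt0.
  have dq : is_derive s 1 (fun s => s ^+ 2 * r t) (2 * s * r t).
    by apply: is_derive_eq; rewrite /GRing.scale /=; ring.
  have de := @is_derive1_comp R G _ s _ _ (G_der sr0) dq.
  rewrite /comp in de.
  apply: is_derive_eq.
  by field; rewrite sn0 gt_eqF.
rewrite /f; apply: is_derive_eq; rewrite /GRing.scale /= /H.
by ring.
Qed.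

Let mr : measurable_fun setT r. Proof. exact: measurable_sqnorm. Qed.

Let co_scE s t : (fun i => s * co t i) = co (sc s t).
Proof. by apply/funext => i; rewrite coE. Qed.

Let r_sc s t : r (sc s t) = s ^+ 2 * r t.
Proof.
rewrite /r /sqnorm mulr_sumr; apply: eq_bigr => i _.
by rewrite coE exprMn.
Qed.

Let F t := gdens k theta sigma (co t) * G (r t).

Let mF : measurable_fun setT F.
Proof.
apply: measurable_funM; first exact: measurable_gdens.
exact: (measurableT_comp mG mr).
Qed.

Let F_ge0 t : 0 <= F t.
Proof. by rewrite mulr_ge0// gdens_ge0. Qed.

Let fE s t : f s t = s ^+ k * F (sc s t).
Proof. by rewrite /f /F /dens co_scE r_sc mulrA. Qed.

Let mf s : measurable_fun setT (f s).
Proof.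
have -> : f s = (fun t => s ^+ k * F (sc s t)) by apply/funext => t; exact: fE.
by apply: measurable_funM => //; apply: (measurableT_comp mF (msc s)).
Qed.

Let f_const s : 0 < s -> Rintegral m setT (f s) = Rintegral m setT F.
Proof.
move=> s0; rewrite /Rintegral; congr fine.
rewrite -(intsc (F := EFin \o F) s0); last 2 first.
- by move=> t; rewrite lee_fin.
- exact/measurable_EFinP.
rewrite -ge0_integralZl//.
- by apply: eq_integral => t _; rewrite fE EFinM.
- by apply/measurable_EFinP; apply: (measurableT_comp mF (msc s)).
- by move=> t _; rewrite lee_fin.
- by rewrite lee_fin exprn_ge0// ltW.
Qed.

Let B0 : 0 <= B. Proof. exact: le_trans (G_ge0 0) (G_le 0). Qed.

(** A neighbourhood of scale [1] whose lower end is the threshold of [gdens_scale_bound]. *)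
Let near1 : set R := `]2^-1, 2[%classic.

Let dominated (X : R -> T -> R) (A : R) : 0 <= A ->
  (forall s t, near1 s -> `|X s t| <= A * (1 + r t)) ->
  exists M : R, 0 <= M /\ forall s t, near1 s ->
    `|s ^+ k * dens s t * X s t| <= M * wgauss k sigma (co t).
Proof.
move=> A0 XA; have [C C0 HC] := gdens_scale_bound k theta sigma0.
exists (2 ^+ k * A * C); split; first by rewrite !mulr_ge0// exprn_ge0.
move=> s t s1; have xa := XA s t s1.
move: s1; rewrite /near1 /= in_itv /= => /andP[sl su].
have d0 : 0 <= dens s t by exact: gdens_ge0.
have sk0 : 0 <= s ^+ k by rewrite exprn_ge0//; lra.
rewrite normrM normrM (ger0_norm sk0) (ger0_norm d0).
have sk : s ^+ k <= 2 ^+ k by rewrite lerXn2r// ?nnegrE; lra.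
apply: (@le_trans _ _ (2 ^+ k * dens s t * (A * (1 + r t)))).
  by apply: ler_pM => //; [exact: mulr_ge0|apply: ler_wpM2r].
have -> : 2 ^+ k * dens s t * (A * (1 + r t)) = 2 ^+ k * A * (dens s t * (1 + r t)) by ring.
rewrite -[leRHS]mulrA; apply: ler_wpM2l; first by rewrite mulr_ge0// exprn_ge0.
by apply: HC; lra.
Qed.

Let H_bound : exists2 A : R, 0 <= A & forall s t, near1 s -> `|H s t| <= A * (1 + r t).
Proof.
have q0 : 0 <= q by exact: sqnorm_ge0.
have sg : 0 < sigma ^+ 2 by rewrite exprn_gt0.
(* Comes from [1/s <= 2], [s <= 2] and [|p| <= r + q]: thus [|s r - p| <= 3 r + q], and the term in
   [dG] is at most [4 B]. *)
exists ((2 * k%:R + (3 + q) / sigma ^+ 2) * B + 4 * B).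
  have ? : 0 <= (3 + q) / sigma ^+ 2 by apply: divr_ge0; [rewrite addr_ge0|exact: ltW].
  by apply: addr_ge0; apply: mulr_ge0 => //; apply: addr_ge0 => //; exact: mulr_ge0.
move=> s t; rewrite /near1 /= in_itv /= => /andP[sl su].
have r0 : 0 <= r t by exact: sqnorm_ge0.
have s0 : 0 < s by lra.
have si : s^-1 <= 2 by rewrite -[leRHS]invrK lef_pV2 ?posrE; lra.
have si0 : 0 <= s^-1 by rewrite invr_ge0 ltW.
have pb : `|p t| <= r t + q by exact: dotp_norm.
have h1 : `|k%:R / s - (s * r t - p t) / sigma ^+ 2| <=
    (2 * k%:R + (3 + q) / sigma ^+ 2) * (1 + r t).
  apply: (le_trans (ler_normB _ _)).
  have a1 : `|k%:R / s| <= 2 * k%:R * (1 + r t).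
    rewrite ger0_norm; last by rewrite mulr_ge0.
    apply: (@le_trans _ _ (2 * k%:R)); first by rewrite mulrC ler_wpM2r.
    by rewrite ler_peMr ?mulr_ge0// lerDl.
  have a2 : `|(s * r t - p t) / sigma ^+ 2| <= (3 + q) / sigma ^+ 2 * (1 + r t).
    rewrite normrM [`|(sigma ^+ 2)^-1|]gtr0_norm ?invr_gt0// mulrAC.
    apply: ler_wpM2r; first by rewrite invr_ge0 ltW.
    apply: (le_trans (ler_normB _ _)).
    have : `|s * r t| <= 2 * r t.
      by rewrite ger0_norm ?mulr_ge0 ?(ltW s0)//; apply: ler_wpM2r => //; exact: ltW.
    have := mulr_ge0 q0 r0.
    by move: pb; lra.
  by rewrite [leRHS]mulrDl; apply: lerD.
have h2 : `|G (s ^+ 2 * r t)| <= B by rewrite ger0_norm.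
have h3 : `|2 * dG (s ^+ 2 * r t) / s| <= 4 * B.
  rewrite normrM normrM (ger0_norm si0) ger0_norm// -mulrA.
  apply: (@le_trans _ _ (2 * (B * 2))); last lra.
  by rewrite ler_pM2l//; apply: ler_pM.
apply: (le_trans (ler_normD _ _)); rewrite [leRHS]mulrDl; apply: lerD.
  by rewrite normrM [leRHS]mulrAC; apply: ler_pM.
by apply: (le_trans h3); rewrite ler_peMr ?mulr_ge0// lerDl.
Qed.

(** The [s]-derivative of [f] at [s = 1]. Its vanishing integral is Stein's identity for the radial
    field [v G(|v|^2)], with divergence [k G + 2 dG]. *)
Definition stein_fun t := gdens k theta sigma (co t) *
  ((k%:R - (r t - p t) / sigma ^+ 2) * G (r t) + 2 * dG (r t)).

Lemma stein_dilation : m.-integrable setT (EFin \o stein_fun) /\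
  (\int[m]_t (stein_fun t)%:E = 0)%E.
Proof.
have [A A0 HA] := H_bound.
have [M [M0 HM]] := dominated A0 HA.
have [M' [M'0 HM']] : exists M : R, 0 <= M /\ forall s t, near1 s ->
    `|s ^+ k * dens s t * G (s ^+ 2 * r t)| <= M * wgauss k sigma (co t).
  apply: (dominated (X := fun s t => G (s ^+ 2 * r t)) B0) => s t _.
  rewrite ger0_norm//; apply: (le_trans (G_le _)).
  by rewrite ler_peMr// lerDl sqnorm_ge0.
have iw := integrable_wgauss sigma0.
have n1 : near1 1 by rewrite /near1 /= in_itv /=; apply/andP; split; lra.
have intf s : near1 s -> m.-integrable setT (EFin \o f s).
  move=> s1; apply: (@integrable_dominated R _ _ m _ _ (fun t => wgauss k sigma (co t)) M') => //.
  by move=> t _; exact: HM'.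
have derf s t : near1 s -> [set: T] t -> derivable (fun s => f s t) s 1.
  rewrite /near1 /= in_itv /= => /andP[s1 _] _.
  have s0 : 0 < s by lra.
  by have [] := f_der t s0.
have d1E s t : near1 s -> partial1of2 f s t = s ^+ k * dens s t * H s t.
  rewrite /near1 /= in_itv /= => /andP[s1 _].
  have s0 : 0 < s by lra.
  by rewrite partial1of2E; have [_ ->] := f_der t s0.
pose MW t := M * wgauss k sigma (co t).
have MW0 t : 0 <= MW t by rewrite /MW mulr_ge0// expR_ge0.
have iMW : m.-integrable setT (EFin \o MW) by exact: (@integrableZl _ _ _ m _ measurableT M _ iw).
have ub s t : near1 s -> [set: T] t -> `|partial1of2 f s t| <= MW t.
  by move=> s1 _; rewrite d1E//; exact: HM.
have := @differentiation_under_integral R _ _ m f setT measurableT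
  1 2^-1 2 n1 intf derf MW MW0 iMW ub.
have -> : derive1 (fun s => Rintegral m setT (f s)) 1 = 0.
  rewrite derive1E.
  have [_ ->//] : is_derive (1 : R) 1 (fun s => Rintegral m setT (f s)) 0.
  apply: (@near_eq_is_derive _ _ _ (cst (Rintegral m setT F))) => //.
    by near=> s; rewrite f_const//; near: s; exact: lt_nbhsr.
move=> E.
have E1 : partial1of2 f 1 = stein_fun.
  apply/funext => t; rewrite d1E// /dens /H expr1n mul1r !expr1n !mul1r !divr1.
  by under eq_fun do rewrite mul1r.
have istein : m.-integrable setT (EFin \o stein_fun).
  apply: (@integrable_dominated R _ _ m _ _ (fun t => wgauss k sigma (co t)) M) => //.
    apply: measurable_funM; first exact: measurable_gdens.
    apply: measurable_funD.
      apply: measurable_funM; last exact: (measurableT_comp mG mr).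
      apply: measurable_funB => //; apply: measurable_funM => //.
      by apply: measurable_funB => //; exact: measurable_dotp.
    by apply: measurable_funM => //; exact: (measurableT_comp mdG mr).
  by move=> t _; rewrite -E1; exact: ub.
split=> //; rewrite -[LHS]fineK; last exact: (integrable_fin_num measurableT istein).
by rewrite -/(Rintegral _ _ _) -E1 -E.
Unshelve. all: by end_near.
Qed.

End SteinDilation.

Lemma iter_int_ge0 {R : realType} (k : nat) (F : (nat -> R) -> \bar R) :
  (forall v, (0 <= F v)%E) -> (0 <= iter_int k F)%E.
Proof.
elim: k F => [|k IH] F F0 /=; first exact: F0.
by apply: integral_ge0 => y _; apply: IH.
Qed.

(** * Comparison of the two risks *)

Section RiskComparison.
Context {R : realType} (p n : nat).
Context (d1 d2 : measure_display) (T1 : measurableType d1) (T2 : measurableType d2).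
Variables (m1 : {sigma_finite_measure set T1 -> \bar R}).
Variables (m2 : {sigma_finite_measure set T2 -> \bar R}).
Variables (co1 : T1 -> nat -> R) (sc1 : R -> T1 -> T1).
Variables (co2 : T2 -> nat -> R) (sc2 : R -> T2 -> T2).
Hypothesis mco1 : forall i, measurable_fun setT (fun t => co1 t i).
Hypothesis mco2 : forall i, measurable_fun setT (fun t => co2 t i).
Hypothesis iterE1 : forall F : (nat -> R) -> \bar R, (forall v, (0 <= F v)%E) ->
  measurable_fun setT (F \o co1) -> iter_int p F = (\int[m1]_t F (co1 t))%E.
Hypothesis iterE2 : forall F : (nat -> R) -> \bar R, (forall v, (0 <= F v)%E) ->
  measurable_fun setT (F \o co2) -> iter_int n F = (\int[m2]_t F (co2 t))%E.
Implicit Types (x : T1) (z : T2) (t : T1 * T2).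

Variables (theta : nat -> R) (sigma : R).
Hypothesis sigma0 : 0 < sigma.

Let r x := sqnorm p (co1 x).
Let S z := sqnorm n (co2 z).
Let W t := r t.1 / S t.2.
Let f1 x := gdens p theta sigma (co1 x).
Let f2 z := gdens n (fun=> 0) sigma (co2 z).

Let mr : measurable_fun setT (fun t => r t.1).
Proof. by apply: (measurableT_comp (measurable_sqnorm mco1 p)); exact: measurable_fst. Qed.

Let mS : measurable_fun setT (fun t => S t.2).
Proof. by apply: (measurableT_comp (measurable_sqnorm mco2 n)); exact: measurable_snd. Qed.

Let mW : measurable_fun setT W.
Proof.
have -> : W = (fun t => r t.1 * S t.2 `^ (-1)).
  by apply/funext => t; rewrite powR_inv1// sqnorm_ge0.
apply: measurable_funM => //.
exact: (@measurableT_comp _ _ _ _ _ _ (fun y : R => y `^ (-1)) _ _ (measurable_powR _) mS).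
Qed.

Let mf1 : measurable_fun setT (fun t => f1 t.1).
Proof. by apply: (measurableT_comp (measurable_gdens mco1 p theta sigma)); exact: measurable_fst. Qed.

Let mf2 : measurable_fun setT (fun t => f2 t.2).
Proof. by apply: (measurableT_comp (measurable_gdens mco2 n (fun=> 0) sigma)); exact: measurable_snd. Qed.

Definition wloss (est : (nat -> R) -> R -> nat -> R) (v w : nat -> R) : R :=
  gdens p theta sigma v * gdens n (fun=> 0) sigma w *
  ((\sum_(i < p) (est v (sqnorm n w) i - theta i) ^+ 2) / sigma ^+ 2).

Lemma risk_integral (est : (nat -> R) -> R -> nat -> R) :
  measurable_fun setT (fun t => wloss est (co1 t.1) (co2 t.2)) ->
  (risk p n est theta sigma =
    \int[m1 \x m2]_t (wloss est (co1 t.1) (co2 t.2))%:E)%E.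
Proof.
move=> mL.
have L0 v w : (0 <= (wloss est v w)%:E)%E.
  rewrite lee_fin mulr_ge0//; first by rewrite mulr_ge0// gdens_ge0.
  by rewrite divr_ge0 ?sqr_ge0//; apply: sumr_ge0 => i _; exact: sqr_ge0.
have meL : measurable_fun setT (fun t => (wloss est (co1 t.1) (co2 t.2))%:E).
  exact/measurable_EFinP.
(* Measurability in [z] is available only along [co1], hence the restriction on [v]. *)
have inner v : (exists x, v = co1 x) -> iter_int n (fun w => (wloss est v w)%:E) =
    (\int[m2]_z (wloss est v (co2 z))%:E)%E.
  move=> [x ->]; rewrite iterE2//.
  apply: (@measurableT_comp _ _ _ _ _ _ (fun t => (wloss est (co1 t.1) (co2 t.2))%:E)
    _ (fun z => (x, z))) => //; exact: measurable_pair1.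
rewrite fubini_tonelli1// /fubini_F /=.
transitivity (iter_int p (fun v => iter_int n (fun w => (wloss est v w)%:E))); first by [].
have mI : measurable_fun setT ((fun v => iter_int n (fun w => (wloss est v w)%:E)) \o co1).
  rewrite (_ : _ \o _ = (fun x => \int[m2]_z (wloss est (co1 x) (co2 z))%:E)%E).
    exact: (measurable_fun_fubini_tonelli_F (m2 := m2)
      (fun t => (wloss est (co1 t.1) (co2 t.2))%:E)).
  by apply/funext => x /=; apply: inner; exists x.
rewrite iterE1//.
  by apply: eq_integral => x _; apply: inner; exists x.
by move=> v; exact: iter_int_ge0.
Qed.

Lemma integrable_wgauss2 : (m1 \x m2)%E.-integrable setT
  (EFin \o (fun t => wgauss p sigma (co1 t.1) * wgauss n sigma (co2 t.2))).
Proof.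
have i1 := integrable_wgauss mco1 iterE1 sigma0.
have i2 := integrable_wgauss mco2 iterE2 sigma0.
have mw1 : measurable_fun setT (fun t => wgauss p sigma (co1 t.1)).
  by apply: (measurableT_comp (measurable_wgauss mco1 p sigma)); exact: measurable_fst.
have mw2 : measurable_fun setT (fun t => wgauss n sigma (co2 t.2)).
  by apply: (measurableT_comp (measurable_wgauss mco2 n sigma)); exact: measurable_snd.
apply/integrable12ltyP.
  by apply/measurable_EFinP; exact: measurable_funM.
pose w1 x := wgauss p sigma (co1 x); pose w2 z := wgauss n sigma (co2 z).
pose I2 := Rintegral m2 setT w2.
have in2 x : (\int[m2]_z `|(w1 x * w2 z)%:E| = I2%:E * (w1 x)%:E)%E.
  transitivity (\int[m2]_z ((w1 x)%:E * (w2 z)%:E))%E.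
    by apply: eq_integral => z _; rewrite gee0_abs ?EFinM// lee_fin mulr_ge0// expR_ge0.
  rewrite integralZl//.
  by rewrite muleC /I2 /Rintegral fineK//; exact: integrable_fin_num i2.
rewrite (eq_integral (fun x => I2%:E * (w1 x)%:E)%E); last by move=> x _; exact: in2.
rewrite integralZl//.
rewrite -[X in (_ * X)%E]fineK; last exact: integrable_fin_num i1.
by rewrite -EFinM ltry.
Qed.

Lemma integrable_gdens2 (X : T1 * T2 -> R) (A : R) : 0 <= A -> measurable_fun setT X ->
  (forall t, `|X t| <= A * ((1 + r t.1) * (1 + S t.2))) ->
  (m1 \x m2)%E.-integrable setT (EFin \o (fun t => f1 t.1 * f2 t.2 * X t)).
Proof.
move=> A0 mX XA.
have [C1 C10 HC1] := gdens_scale_bound p theta sigma0.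
have [C2 C20 HC2] := gdens_scale_bound n (fun=> 0) sigma0.
have b1 x : f1 x * (1 + r x) <= C1 * wgauss p sigma (co1 x).
  have h : (2^-1 : R) <= 1 by lra.
  have := HC1 1 (co1 x) h.
  by under [X in gdens _ _ _ X]eq_fun do rewrite mul1r.
have b2 z : f2 z * (1 + S z) <= C2 * wgauss n sigma (co2 z).
  have h : (2^-1 : R) <= 1 by lra.
  have := HC2 1 (co2 z) h.
  by under [X in gdens _ _ _ X]eq_fun do rewrite mul1r.
apply: (@integrable_dominated R _ _ (m1 \x m2)%E _ _
  (fun t => wgauss p sigma (co1 t.1) * wgauss n sigma (co2 t.2)) (A * (C1 * C2))) => //.
- by apply: measurable_funM => //; exact: measurable_funM.
- exact: integrable_wgauss2.
move=> t _.
have d1' : 0 <= f1 t.1 by exact: gdens_ge0.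
have d2' : 0 <= f2 t.2 by exact: gdens_ge0.
rewrite normrM ger0_norm ?mulr_ge0//.
apply: (@le_trans _ _ (A * ((f1 t.1 * (1 + r t.1)) * (f2 t.2 * (1 + S t.2))))).
  have -> : A * (f1 t.1 * (1 + r t.1) * (f2 t.2 * (1 + S t.2))) =
    f1 t.1 * f2 t.2 * (A * ((1 + r t.1) * (1 + S t.2))) by ring.
  by apply: ler_wpM2l => //; exact: mulr_ge0.
have -> : A * (C1 * C2) * (wgauss p sigma (co1 t.1) * wgauss n sigma (co2 t.2)) =
   A * ((C1 * wgauss p sigma (co1 t.1)) * (C2 * wgauss n sigma (co2 t.2))) by ring.
apply: ler_wpM2l => //; apply: ler_pM => //.
  by rewrite mulr_ge0// addr_ge0// sqnorm_ge0.
by rewrite mulr_ge0// addr_ge0// sqnorm_ge0.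
Qed.

Hypothesis coE1 : forall r x i, co1 (sc1 r x) i = r * co1 x i.
Hypothesis coE2 : forall r z i, co2 (sc2 r z) i = r * co2 z i.
Hypothesis msc1 : forall r, measurable_fun setT (sc1 r).
Hypothesis msc2 : forall r, measurable_fun setT (sc2 r).
Hypothesis intsc1 : forall (r : R) (F : T1 -> \bar R), 0 < r ->
  (forall x, (0 <= F x)%E) -> measurable_fun setT F ->
  ((r ^+ p)%:E * \int[m1]_x F (sc1 r x) = \int[m1]_x F x)%E.
Hypothesis intsc2 : forall (r : R) (F : T2 -> \bar R), 0 < r ->
  (forall z, (0 <= F z)%E) -> measurable_fun setT F ->
  ((r ^+ n)%:E * \int[m2]_z F (sc2 r z) = \int[m2]_z F z)%E.

Variables (g g1 : R -> R) (B : R).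
Implicit Types w s y : R.
Hypotheses (mg : measurable_fun setT g) (mg1 : measurable_fun setT g1).
Hypotheses (g0 : g 0 = 0) (g10 : g1 0 = 0).
Hypothesis g_der : forall w : R, 0 < w -> is_derive w 1 g (g1 w / w).
Hypothesis g_ge0 : forall w, 0 <= g w.
Hypothesis g_le : forall w, g w <= B.
Hypothesis g1_le : forall w, `|g1 w| <= B.
Hypothesis v_ge0 : forall w, 0 <= w * g w ^+ 2.
Hypothesis v_le : forall w, w * g w ^+ 2 <= B.
Hypothesis v1_le : forall w, `|w * g w * g1 w| <= B.

(** Chosen so that [v(W) S = g(W)^2 |X|^2]; [v1] is [w v'(w)]. *)
Let v w := w * g w ^+ 2.
Let v1 w := v w + 2 * (w * g w * g1 w).

Hypothesis risk_ineq : forall w,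
  n%:R * v w - 2 * v1 w - 2 * p%:R * g w - 4 * g1 w <= 0.

Let mv : measurable_fun setT v.
Proof. by apply: measurable_funM => //; exact: measurable_funX. Qed.

Let mv1 : measurable_fun setT v1.
Proof.
apply: measurable_funD => //; apply: measurable_funM => //.
by apply: measurable_funM => //; exact: measurable_funM.
Qed.

Let B0 : 0 <= B. Proof. exact: le_trans (g_ge0 0) (g_le 0). Qed.

Let v1_bound w : `|v1 w| <= 3 * B.
Proof.
apply: (le_trans (ler_normD _ _)); rewrite (ger0_norm (v_ge0 w : 0 <= v w)).
rewrite normrM (ger0_norm (ler0n R 2)).
have := v_le w; have := v1_le w; rewrite -/(v w).
by move: (v w) (`|w * g w * g1 w|) => a b; lra.
Qed.

Let v_der w : 0 < w -> is_derive w 1 v (v1 w / w).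
Proof.
move=> w0; have dg := g_der w0; have wn0 : w != 0 by rewrite gt_eqF.
have -> : v = (fun w => w * (g w * g w)) by apply/funext => y; rewrite /v expr2.
apply: is_derive_eq; rewrite /GRing.scale /= /v1 /v.
by field.
Qed.

(** [sigma^2] times Stein's integrand in the [Z] block for [s -> v(|X|^2 / s)]. As [s] is in the
    denominator, [s d/ds] gives [- v1]. *)
Let Psi1 t := f1 t.1 * f2 t.2 *
  (sigma ^+ 2 * (n%:R * v (W t) - 2 * v1 (W t)) - v (W t) * S t.2).

(** The analogue in the [X] block, for [s -> g(s / S)]. *)
Let Psi2 t := f1 t.1 * f2 t.2 *
  (sigma ^+ 2 * (p%:R * g (W t) + 2 * g1 (W t)) -
   g (W t) * (r t.1 - dotp p (co1 t.1) theta)).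

Let sg0 : 0 < sigma ^+ 2. Proof. by rewrite exprn_gt0. Qed.

Let Psi1_inner x : (\int[m2]_z (Psi1 (x, z))%:E = 0)%E.
Proof.
(* The power [-1] is measurable on the whole line and agrees with the inverse at nonnegative
   arguments, [0] included. *)
pose G s := v (r x * s `^ (-1)).
pose dG s := - v1 (r x * s `^ (-1)).
have minv : measurable_fun setT (fun s : R => r x * s `^ (-1)).
  by apply: measurable_funM => //; exact: measurable_powR.
have mG : measurable_fun setT G by exact: (measurableT_comp mv minv).
have mdG : measurable_fun setT dG.
  by apply: measurableT_comp => //; exact: (measurableT_comp mv1 minv).
have G0 s : 0 <= G s by exact: v_ge0.
have GB s : G s <= 3 * B.
  by apply: (le_trans (v_le _)); rewrite ler_peMl// ler1n.
have dGB s : `|dG s| <= 3 * B by rewrite normrN; exact: v1_bound.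
have v10 : v1 0 = 0 by rewrite /v1 /v !mul0r mulr0 addr0.
have dG0 : dG 0 = 0.
  by rewrite /dG powR0 ?mulr0 ?v10 ?oppr0// oppr_eq0 oner_eq0.
have Gder s : 0 < s -> is_derive s 1 G (dG s / s).
  move=> s0; have sn0 : s != 0 by rewrite gt_eqF.
  have : 0 <= r x by exact: sqnorm_ge0.
  rewrite le_eqVlt => /orP[/eqP r0|r0].
    have -> : G = cst 0 by apply/funext => y; rewrite /G -r0 mul0r /v mul0r.
    by rewrite /dG -r0 mul0r v10 oppr0 mul0r; apply: is_derive_cst.
  have w0 : 0 < r x * s `^ (-1) by rewrite mulr_gt0// powR_gt0.
  have dp : is_derive s 1 (fun s : R => s `^ (-1)) (-1 * s `^ (-1 - 1)).
    exact: is_derive1_powR.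
  have dq : is_derive s 1 (fun s => r x * s `^ (-1)) (- (r x * s `^ (-1) / s)).
    apply: is_derive_eq; rewrite /GRing.scale /=.
    have -> : s `^ (-1) = s * s `^ (-1 - 1) by rewrite -powRS// subrK.
    by field.
  have de := @is_derive1_comp R v _ s _ _ (v_der w0) dq.
  rewrite /comp in de; rewrite /G; apply: is_derive_eq.
  rewrite /dG; move: (r x * s `^ (-1)) w0 => w w0.
  by field; rewrite sn0 gt_eqF.
have [iS S0] := stein_dilation mco2 iterE2 coE2 msc2 intsc2 (fun=> 0) sigma0
  mG mdG G0 GB dGB dG0 Gder.
transitivity (\int[m2]_z ((f1 x * sigma ^+ 2)%:E *
    (stein_fun n co2 (fun=> 0) sigma G dG z)%:E))%E.
  apply: eq_integral => z _; rewrite -EFinM; congr EFin.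
  rewrite /Psi1 /stein_fun /G /dG /W /= powR_inv1 ?sqnorm_ge0//.
  have -> : dotp n (co2 z) (fun=> 0) = 0 by rewrite /dotp big1// => i _; rewrite mulr0.
  rewrite -/(S z) -/(f2 z).
  by field; rewrite gt_eqF.
by rewrite integralZl// S0 mule0.
Qed.

Let Psi2_inner z : (\int[m1]_x (Psi2 (x, z))%:E = 0)%E.
Proof.
pose G s := g (s / S z).
pose dG s := g1 (s / S z).
have minv : measurable_fun setT (fun s : R => s / S z) by exact: measurable_funM.
have mG : measurable_fun setT G by exact: (measurableT_comp mg minv).
have mdG : measurable_fun setT dG by exact: (measurableT_comp mg1 minv).
have G0 s : 0 <= G s by exact: g_ge0.
have GB s : G s <= B by exact: g_le.
have dGB s : `|dG s| <= B by exact: g1_le.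
have dG0 : dG 0 = 0 by rewrite /dG mul0r.
have Gder s : 0 < s -> is_derive s 1 G (dG s / s).
  move=> s0; have sn0 : s != 0 by rewrite gt_eqF.
  have : 0 <= S z by exact: sqnorm_ge0.
  rewrite le_eqVlt => /orP[/eqP r0|r0].
    have -> : G = cst 0 by apply/funext => y; rewrite /G -r0 invr0 mulr0.
    by rewrite /dG -r0 invr0 mulr0 g10 mul0r; apply: is_derive_cst.
  have w0 : 0 < s / S z by rewrite divr_gt0.
  have dq : is_derive s 1 (fun s => s / S z) ((S z)^-1).
    by apply: is_derive_eq; rewrite /GRing.scale /=; ring.
  have de := @is_derive1_comp R g _ s _ _ (g_der w0) dq.
  rewrite /comp in de; rewrite /G; apply: is_derive_eq.
  rewrite /dG; move: (g1 _) => c.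
  by field; rewrite sn0 gt_eqF.
have [iS S0] := stein_dilation mco1 iterE1 coE1 msc1 intsc1 theta sigma0
  mG mdG G0 GB dGB dG0 Gder.
transitivity (\int[m1]_x ((f2 z * sigma ^+ 2)%:E *
    (stein_fun p co1 theta sigma G dG x)%:E))%E.
  apply: eq_integral => x _; rewrite -EFinM; congr EFin.
  rewrite /Psi2 /stein_fun /G /dG /W /= -/(r x) -/(f1 x).
  by field; rewrite gt_eqF.
by rewrite integralZl// S0 mule0.
Qed.

Let r_ge0 x : 0 <= r x. Proof. exact: sqnorm_ge0. Qed.
Let S_ge0 z : 0 <= S z. Proof. exact: sqnorm_ge0. Qed.

Let affine_bound (a b c : R) t : 0 <= a -> 0 <= b -> 0 <= c ->
  a + b * r t.1 + c * S t.2 <= (a + b + c) * ((1 + r t.1) * (1 + S t.2)).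
Proof.
move=> a0 b0 c0; move: (r t.1) (S t.2) (r_ge0 t.1) (S_ge0 t.2) => x y x0 y0.
have xy := mulr_ge0 x0 y0.
have := mulr_ge0 a0 x0; have := mulr_ge0 a0 y0; have := mulr_ge0 a0 xy.
have := mulr_ge0 b0 y0; have := mulr_ge0 b0 xy.
have := mulr_ge0 c0 x0; have := mulr_ge0 c0 xy.
by lra.
Qed.

Let mvW : measurable_fun setT (fun t => v (W t)).
Proof. exact: (measurableT_comp mv mW). Qed.
Let mv1W : measurable_fun setT (fun t => v1 (W t)).
Proof. exact: (measurableT_comp mv1 mW). Qed.
Let mgW : measurable_fun setT (fun t => g (W t)).
Proof. exact: (measurableT_comp mg mW). Qed.
Let mg1W : measurable_fun setT (fun t => g1 (W t)).
Proof. exact: (measurableT_comp mg1 mW). Qed.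
Let mp' : measurable_fun setT (fun t => dotp p (co1 t.1) theta).
Proof. by apply: (measurableT_comp (measurable_dotp mco1 p theta)); exact: measurable_fst. Qed.

Let iPsi1 : (m1 \x m2)%E.-integrable setT (EFin \o Psi1).
Proof.
have a0 : 0 <= sigma ^+ 2 * ((n%:R + 6) * B).
  by rewrite mulr_ge0 ?(ltW sg0)// mulr_ge0// addr_ge0.
apply: (@integrable_gdens2 _ (sigma ^+ 2 * ((n%:R + 6) * B) + 0 + B)).
- by rewrite !addr_ge0.
- apply: measurable_funB; last exact: measurable_funM.
  apply: measurable_funM => //; apply: measurable_funB; exact: measurable_funM.
- move=> t; apply: le_trans (affine_bound t a0 (lexx 0) B0).
  rewrite mul0r addr0; apply: (le_trans (ler_normB _ _)); apply: lerD.
    rewrite normrM (ger0_norm (ltW sg0)) ler_pM2l//.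
    apply: (le_trans (ler_normB _ _)); rewrite [leRHS]mulrDl; apply: lerD.
      rewrite normrM (ger0_norm (ler0n R n)) (ger0_norm (v_ge0 (W t) : 0 <= v (W t))).
      by apply: ler_wpM2l => //; exact: v_le.
    rewrite normrM (ger0_norm (ler0n R 2)).
    by have := v1_bound (W t); move: (`|v1 (W t)|) => c; lra.
  rewrite normrM (ger0_norm (v_ge0 (W t) : 0 <= v (W t))) (ger0_norm (S_ge0 _)).
  by apply: ler_wpM2r => //; exact: v_le.
Qed.

Let iPsi2 : (m1 \x m2)%E.-integrable setT (EFin \o Psi2).
Proof.
have q0 := sqnorm_ge0 p theta.
have a0 : 0 <= sigma ^+ 2 * ((p%:R + 2) * B) + B * sqnorm p theta.
  by apply: addr_ge0; apply: mulr_ge0 => //; [exact: ltW|apply: mulr_ge0 => //; exact: addr_ge0].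
have b0 : 0 <= B * 2 by rewrite mulr_ge0.
apply: (@integrable_gdens2 _ (sigma ^+ 2 * ((p%:R + 2) * B) + B * sqnorm p theta + B * 2 + 0)).
- by rewrite addr_ge0// addr_ge0.
- apply: measurable_funB.
    by apply: measurable_funM => //; apply: measurable_funD; exact: measurable_funM.
  by apply: measurable_funM => //; exact: measurable_funB.
- move=> t; apply: le_trans (affine_bound t a0 b0 (lexx 0)).
  rewrite mul0r addr0 -addrA; apply: (le_trans (ler_normB _ _)); apply: lerD.
    rewrite normrM (ger0_norm (ltW sg0)) ler_pM2l//.
    apply: (le_trans (ler_normD _ _)); rewrite [leRHS]mulrDl; apply: lerD.
      rewrite normrM (ger0_norm (ler0n R p)) (ger0_norm (g_ge0 _)).
      by apply: ler_wpM2l => //; exact: g_le.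
    rewrite normrM (ger0_norm (ler0n R 2)).
    by apply: ler_wpM2l => //; exact: g1_le.
  rewrite normrM (ger0_norm (g_ge0 _)).
  apply: (@le_trans _ _ (B * (sqnorm p theta + 2 * r t.1))); last first.
    by rewrite mulrDr mulrA.
  apply: ler_pM => //.
  apply: (le_trans (ler_normB _ _)); rewrite (ger0_norm (r_ge0 _)).
  have := dotp_norm p (co1 t.1) theta; rewrite -/(r t.1).
  by move: (r t.1) (`|dotp _ _ _|) => a b; lra.
Qed.

Let int_Psi1 : Rintegral (m1 \x m2)%E setT Psi1 = 0.
Proof.
rewrite /Rintegral -(integral12_prod_meas1 iPsi1) /fubini_F.
rewrite (eq_integral (cst 0%E)); first by rewrite integral0.
by move=> x _; exact: Psi1_inner.
Qed.

Let int_Psi2 : Rintegral (m1 \x m2)%E setT Psi2 = 0.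
Proof.
rewrite /Rintegral -(integral21_prod_meas1 iPsi2) /fubini_G.
rewrite (eq_integral (cst 0%E)); first by rewrite integral0.
by move=> x _; exact: Psi2_inner.
Qed.

Lemma sqdist_scale (k : nat) (c : R) (u : nat -> R) :
  \sum_(i < k) (c * u i - theta i) ^+ 2 =
  c ^+ 2 * sqnorm k u - 2 * c * dotp k u theta + sqnorm k theta.
Proof.
rewrite /sqnorm /dotp !mulr_sumr -sumrB -big_split /=.
by apply: eq_bigr => i _; ring.
Qed.

Definition shrink_est (x : nat -> R) (s : R) : nat -> R :=
  fun i => (1 - g (sqnorm p x / s)) * x i.

Let lossXE t : wloss (@est_X R) (co1 t.1) (co2 t.2) =
  f1 t.1 * f2 t.2 * ((r t.1 - 2 * dotp p (co1 t.1) theta + sqnorm p theta) / sigma ^+ 2).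
Proof.
rewrite /wloss /est_X; congr (_ * _ * (_ / _)).
have := sqdist_scale p 1 (co1 t.1); rewrite expr1n mul1r mulr1 => <-.
by apply: eq_bigr => i _; rewrite mul1r.
Qed.

Let lossdE t : wloss shrink_est (co1 t.1) (co2 t.2) =
  f1 t.1 * f2 t.2 * (((1 - g (W t)) ^+ 2 * r t.1
    - 2 * (1 - g (W t)) * dotp p (co1 t.1) theta + sqnorm p theta) / sigma ^+ 2).
Proof. by rewrite /wloss /shrink_est sqdist_scale. Qed.

Let mlossX : measurable_fun setT (fun t => wloss (@est_X R) (co1 t.1) (co2 t.2)).
Proof.
under eq_fun do rewrite lossXE.
apply: measurable_funM; first exact: measurable_funM.
apply: measurable_funM => //; apply: measurable_funD => //.
by apply: measurable_funB => //; exact: measurable_funM.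
Qed.

Let mlossd : measurable_fun setT (fun t => wloss shrink_est (co1 t.1) (co2 t.2)).
Proof.
under eq_fun do rewrite lossdE.
have m1g : measurable_fun setT (fun t => 1 - g (W t)) by exact: measurable_funB.
apply: measurable_funM; first exact: measurable_funM.
apply: measurable_funM => //; apply: measurable_funD => //.
apply: measurable_funB.
  by apply: measurable_funM => //; exact: measurable_funX.
by apply: measurable_funM => //; exact: measurable_funM.
Qed.

Let ilossX : (m1 \x m2)%E.-integrable setT
  (EFin \o (fun t => wloss (@est_X R) (co1 t.1) (co2 t.2))).
Proof.
have q0 := sqnorm_ge0 p theta.
have a0 : 0 <= 3 * sqnorm p theta / sigma ^+ 2.
  by rewrite divr_ge0 ?mulr_ge0// ltW.
have b0 : 0 <= 3 / sigma ^+ 2 by rewrite divr_ge0// ltW.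
have -> : (fun t => wloss (@est_X R) (co1 t.1) (co2 t.2)) = (fun t => f1 t.1 * f2 t.2 *
    ((r t.1 - 2 * dotp p (co1 t.1) theta + sqnorm p theta) / sigma ^+ 2)).
  by apply/funext => t; exact: lossXE.
apply: (@integrable_gdens2 _ (3 * sqnorm p theta / sigma ^+ 2 + 3 / sigma ^+ 2 + 0)).
- by rewrite addr_ge0// addr_ge0.
- apply: measurable_funM => //; apply: measurable_funD => //.
  by apply: measurable_funB => //; exact: measurable_funM.
- move=> t; apply: le_trans (affine_bound t a0 b0 (lexx 0)).
  have -> : 3 * sqnorm p theta / sigma ^+ 2 + 3 / sigma ^+ 2 * r t.1 + 0 * S t.2 =
    (3 * sqnorm p theta + 3 * r t.1) / sigma ^+ 2 by ring.
  rewrite normrM [`|(sigma ^+ 2)^-1|]ger0_norm ?invr_ge0 ?(ltW sg0)//.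
  apply: ler_wpM2r; first by rewrite invr_ge0 ltW.
  have := dotp_norm p (co1 t.1) theta; rewrite -/(r t.1) ler_norml => /andP[h1 h2].
  by have := r_ge0 t.1; rewrite ler_norml => r0; apply/andP; split; lra.
Qed.

(** At [S = 0] the division convention gives [W = 0], and [g 0 = 0] makes both sides vanish. *)
Let g2r t : g (W t) ^+ 2 * r t.1 = v (W t) * S t.2.
Proof.
rewrite /v /W; have [S0|S0] := eqVneq (S t.2) 0.
  by rewrite S0 invr0 mulr0 g0 expr0n /= !mul0r.
by field.
Qed.

(** The coefficients [- 1/sigma^2] and [2/sigma^2] cancel the terms in [v S] and in
    [g (|X|^2 - X'theta)]. What remains is the joint density times the left side of [risk_ineq]. *)
Let loss_le t : wloss shrink_est (co1 t.1) (co2 t.2) <=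
  1 * wloss (@est_X R) (co1 t.1) (co2 t.2) + (- (sigma ^+ 2)^-1) * Psi1 t +
  (2 / sigma ^+ 2) * Psi2 t.
Proof.
rewrite lossXE lossdE /Psi1 /Psi2.
have ff : 0 <= f1 t.1 * f2 t.2 by rewrite mulr_ge0// gdens_ge0.
move: (f1 t.1 * f2 t.2) ff => f f0; rewrite -subr_ge0.
have sn0 : sigma != 0 by rewrite gt_eqF.
set X := (X in 0 <= X).
have -> : X = f * - (n%:R * v (W t) - 2 * v1 (W t) - 2 * p%:R * g (W t) - 4 * g1 (W t))
   + f / sigma ^+ 2 * (v (W t) * S t.2 - g (W t) ^+ 2 * r t.1).
  by rewrite /X; field.
rewrite g2r subrr mulr0 addr0 mulr_ge0// oppr_ge0.
exact: risk_ineq.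
Qed.

(** The majorant in [loss_le] is integrable and [Psi1], [Psi2] integrate to [0], so its integral is
    the risk of [X]; finiteness of the other risk comes with the comparison. *)
Lemma risk_shrink_le :
  (risk p n shrink_est theta sigma <= risk p n (@est_X R) theta sigma)%E.
Proof.
rewrite !risk_integral//.
have [iY YE] := Rintegral_lin3 (mu := (m1 \x m2)%E) measurableT ilossX iPsi1 iPsi2
  (fun t _ => erefl (1 * wloss (@est_X R) (co1 t.1) (co2 t.2) +
    (- (sigma ^+ 2)^-1) * Psi1 t + (2 / sigma ^+ 2) * Psi2 t)).
rewrite int_Psi1 int_Psi2 !mulr0 !addr0 mul1r in YE.
rewrite -[leRHS]fineK; last exact: (integrable_fin_num measurableT ilossX).
rewrite -/(Rintegral _ _ _) -YE /Rintegral fineK; last exact: (integrable_fin_num measurableT iY).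
apply: ge0_le_integral => //.
- move=> t _; rewrite lee_fin mulr_ge0//; first by rewrite mulr_ge0// gdens_ge0.
  by rewrite divr_ge0 ?sqr_ge0//; apply: sumr_ge0 => i _; exact: sqr_ge0.
- exact/measurable_EFinP.
- exact: (measurable_int (m1 \x m2)%E iY).
- by move=> t _; rewrite lee_fin.
Qed.

End RiskComparison.

Lemma measurable_fun_invr_ge0 {R : realType} (d : measure_display)
    (T : measurableType d) (D : set T) (f : T -> R) : measurable D ->
  measurable_fun D f -> (forall x, D x -> 0 <= f x) ->
  measurable_fun D (fun x => (f x)^-1).
Proof.
move=> mD mf f0; apply: (eq_measurable_fun (fun x => f x `^ (-1))).
  by move=> x; rewrite inE => Dx; rewrite powR_inv1// f0.
exact: (@measurableT_comp _ _ _ _ _ _ (fun y : R => y `^ (-1)) _ _ (measurable_powR _) mf).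
Qed.

(** * Minimaxity of the generalized Bayes estimator *)

Section Minimax.
Context {R : realType}.
Variables (p n : nat) (a b e : R).
Let h := p%:R / 2 + a + 1.
Let q := n%:R / 2 + e - a.
Hypotheses (h0 : 0 < h) (q0 : 0 < q) (b1 : -1 < b).
Implicit Types w : R.
Local Notation phi := (bratio h q b).
Local Notation L := (logslope h q b phi).

(** The value [0] at [w = 0] agrees with division by zero in [gb_delta]. The extension to negative
    [w] only serves to have measurability and bounds on the whole line. *)
Let shr w := if 0 < w then phi w / w else 0.
Let shr1 w := if 0 < w then phi w / w * (L w - 1) else 0.

Lemma gb_phiE w : 0 <= w -> gb_phi p n a b e w = phi w.
Proof.
move=> w0; rewrite /gb_phi /bratio.
have -> : p%:R / 2 + n%:R / 2 + e + 2 = h + q + 1 by rewrite /h /q; field.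
have -> : p%:R / 2 + a = h - 1 by rewrite /h; ring.
by rewrite subrK -!Rintegral_bker_cc.
Qed.

Let shrE w : 0 <= w -> gb_phi p n a b e w / w = shr w.
Proof.
move=> w0; rewrite gb_phiE// /shr; case: ltgtP w0 => // <- _.
by rewrite invr0 mulr0.
Qed.

Let D : set R := `]0, +oo[%classic.
Let mD : measurable D. Proof. exact: measurable_itv. Qed.

Let DE w : D w = (0 < w) :> Prop.
Proof. by rewrite /D /= in_itv /= andbT. Qed.

Let mphi : measurable_fun D phi.
Proof.
apply: open_continuous_measurable_fun; first exact: interval_open.
move=> w; rewrite inE DE => w0.
apply/differentiable_continuous/derivable1_diffP.
by have [] := bratio_der h0 q0 b1 w0.
Qed.

Let mid : measurable_fun D (fun w : R => w). Proof. exact: measurable_funTS. Qed.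

Let mratio : measurable_fun D (fun w => phi w / w).
Proof.
apply: measurable_funM => //; apply: measurable_fun_invr_ge0 => //.
by move=> w; rewrite DE => /ltW.
Qed.

Let mL : measurable_fun D L.
Proof.
rewrite /logslope; apply: measurable_funM; last first.
  apply: measurable_fun_invr_ge0 => //; first exact: measurable_funD.
  by move=> w; rewrite DE => w0; rewrite addr_ge0// ltW.
apply: measurable_funB => //; apply: measurable_funD; last exact: measurable_funM.
apply: measurable_funB => //; apply: measurable_funB; last exact: measurable_funM.
apply: measurable_funM; first exact: measurable_funM.
apply: measurable_fun_invr_ge0 => //.
by move=> w; rewrite DE => w0; rewrite ltW// bratio_gt0.
Qed.

Let mif (f : R -> R) : measurable_fun D f ->
  measurable_fun setT (fun w => if 0 < w then f w else 0).
Proof.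
move=> mf; have -> : (fun w => if 0 < w then f w else 0) = f \_ D.
  apply/funext => w; rewrite patchE.
  by case: ifPn => w0; [rewrite mem_set// DE|rewrite memNset// DE; exact/negP].
by apply/(measurable_restrictT f).
Qed.

Let mshr : measurable_fun setT shr. Proof. exact: mif. Qed.

Let mshr1 : measurable_fun setT shr1.
Proof.
by apply: mif; apply: measurable_funM => //; exact: measurable_funB.
Qed.

Let shr_der w : 0 < w -> is_derive w 1 shr (shr1 w / w).
Proof.
move=> w0; have dphi := bratio_der h0 q0 b1 w0.
have wn0 : w != 0 by rewrite gt_eqF.
have dV : is_derive w 1 (fun w : R => w^-1) (- w ^- 2 *: 1) by exact: is_deriveV.
apply: (@near_eq_is_derive _ _ _ (fun w => phi w / w)).
  by near=> y; rewrite /shr ifT//; near: y; exact: lt_nbhsr.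
rewrite /shr1 w0; apply: is_derive_eq; rewrite /GRing.scale /=.
by field.
Unshelve. all: by end_near.
Qed.

Lemma minimax_of_good_shrinkage :
  good_shrinkage h q b p%:R n%:R -> minimax p n (gb_delta p n a b e).
Proof.
move=> [C HC] theta sigma sigma0.
have C0 : 0 < C.
  by have [h1 _] := HC 1 ltr01; apply: lt_le_trans h1; exact: bratio_gt0.
pose k := h + q + 1.
have k0 : 0 < k by exact: addr_gt0 (addr_gt0 h0 q0) ltr01.
(* The summands bound in turn [g], [g1], [w g^2] and [w g g1], by [phi < w], [|L - 1| <= k] and
   [phi <= C]. *)
pose B := 1 + k + C + C * k.
have Ck : 0 < C * k by exact: mulr_gt0.
have B0 : 0 <= B by rewrite /B; lra.
have sr w : 0 < w -> 0 < phi w / w <= 1.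
  move=> w0; rewrite divr_gt0 ?bratio_gt0//= ler_pdivrMr// mul1r ltW//.
  exact: bratio_lt.
have Lk w : 0 < w -> `|L w - 1| <= k by move=> w0; exact: logslope_bratio_bound.
have [d1 [T1 [m1 [co1 [sc1 [mco1 iterE1 coE1 msc1 intsc1]]]]]] := @coord_space R p.
have [d2 [T2 [m2 [co2 [sc2 [mco2 iterE2 coE2 msc2 intsc2]]]]]] := @coord_space R n.
have -> : risk p n (gb_delta p n a b e) theta sigma = risk p n (shrink_est p shr) theta sigma.
  rewrite /risk; congr iter_int; apply/funext => x; congr iter_int; apply/funext => z.
  congr EFin; congr (_ * (_ / _)); apply: eq_bigr => i _.
  by rewrite /gb_delta /shrink_est shrE// divr_ge0// sqnorm_ge0.
apply: (@risk_shrink_le R p n d1 d2 T1 T2 m1 m2 co1 sc1 co2 sc2 mco1 mco2 iterE1 iterE2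
  theta sigma sigma0 coE1 coE2 msc1 msc2 intsc1 intsc2 shr shr1 B) => //.
- by rewrite /shr ltxx.
- by rewrite /shr1 ltxx.
- by move=> w; rewrite /shr; case: ifPn => // /sr /andP[/ltW].
- move=> w; rewrite /shr; case: ifPn => // /sr /andP[_ h1].
  by apply: (le_trans h1); rewrite /B; lra.
- move=> w; rewrite /shr1; case: ifPn => [w0|_]; last by rewrite normr0.
  have /andP[s0 s1] := sr _ w0; rewrite normrM gtr0_norm//.
  apply: (@le_trans _ _ (1 * k)); last by rewrite /B; lra.
  by apply: ler_pM => //; [exact: ltW|exact: Lk].
- move=> w; rewrite /shr; case: ifPn => w0; last by rewrite expr0n mulr0.
  by rewrite mulr_ge0 ?sqr_ge0// ltW.
- move=> w; rewrite /shr; case: ifPn => w0; last by rewrite expr0n mulr0.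
  have /andP[s0 s1] := sr _ w0; have [hC _] := HC _ w0.
  have -> : w * (phi w / w) ^+ 2 = phi w * (phi w / w) by field; rewrite gt_eqF.
  apply: (@le_trans _ _ (C * 1)); last by rewrite /B; lra.
  by apply: ler_pM => //; apply: ltW => //; exact: bratio_gt0.
- move=> w; rewrite /shr /shr1; case: ifPn => w0; last by rewrite !mulr0 normr0.
  have /andP[s0 s1] := sr _ w0; have [hC _] := HC _ w0.
  have p0 : 0 < phi w by exact: bratio_gt0.
  have -> : w * (phi w / w) * (phi w / w * (L w - 1)) =
    phi w * (phi w / w) * (L w - 1) by field; rewrite gt_eqF.
  rewrite normrM (gtr0_norm (mulr_gt0 p0 s0)).
  apply: (@le_trans _ _ (C * 1 * k)); last by rewrite /B; lra.
  have h1 : phi w * (phi w / w) <= C * 1.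
    exact: ler_pM (ltW p0) (ltW s0) hC s1.
  exact: ler_pM (ltW (mulr_gt0 p0 s0)) (normr_ge0 _) h1 (Lk _ w0).
- move=> w; rewrite /shr /shr1; case: ifPn => w0; last first.
    by rewrite expr0n /= !(mulr0, mul0r) !(addr0, subr0).
  have /andP[s0 s1] := sr _ w0; have [_ T0] := HC _ w0.
  set X := (X in X <= 0).
  have -> : X = - (phi w / w * (2 * (p%:R - 2) - (n%:R + 2) * phi w +
      4 * ((1 + phi w) * L w))).
    by rewrite /X; move: (L w) => l; field; rewrite gt_eqF.
  by rewrite oppr_le0 mulr_ge0// ltW.
Qed.

End Minimax.

Theorem theorem3p7 (R : realType) (p n : nat) (a b e : R) :
  (3 <= p)%N -> (1 <= n)%N ->
  - (p%:R / 2) - n%:R / 2 - 1 < e ->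
  let c := 2 * (p%:R - 2) / (n%:R + 2) in
  let alpha := (p%:R / 2 + a + 1) / (n%:R / 2 + e - a) in
  ((- (p%:R / 2) - 1 < a) ->
   (a <= (c * (n%:R / 2 + e) - p%:R / 2 - 1) / (1 + c)) ->
   (Num.min (n%:R / 2 + e - a - 1) 0 <= b) ->
   minimax p n (gb_delta p n a b e))
  /\
  ((- (p%:R / 2) - 1 < a) ->
   (a < (c * (n%:R / 2 + e) - p%:R / 2 - 1) / (1 + c)) ->
   (-1 < - ((n%:R + 2) * (c - alpha) / (4 * (p%:R + a + 1) * (alpha + 1)))) ->
   (- ((n%:R + 2) * (c - alpha) / (4 * (p%:R + a + 1) * (alpha + 1))) <= b) ->
   (b < Num.min 0 (n%:R / 2 + e - a - 1)) ->
   minimax p n (gb_delta p n a b e)).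
Proof.
move=> p3 _ _ c alpha.
have P2 : (2 : R) < p%:R by rewrite ltr_nat.
have n0 : (0 : R) <= n%:R by [].
have n2 : (0 : R) < n%:R + 2 by lra.
have c0 : 0 < c by rewrite /c divr_gt0//; lra.
have cE : (n%:R + 2) * c = 2 * (p%:R - 2) by rewrite /c; field; lra.
have h_le : forall h q : R, 0 < h -> h <= c * q ->
    0 < q /\ (n%:R + 2) * h <= 2 * (p%:R - 2) * q.
  move=> h q h0 hcq; have cq0 : 0 < c * q by apply: lt_le_trans hcq.
  split; first by rewrite pmulr_rgt0 in cq0.
  by rewrite -cE -mulrA ler_pM2l.
(* Clearing [1 + c] shows that the condition on [a] says [h <= c q], from which [h_le] also extracts
   [q > 0]. *)
have a_le : a <= (c * (n%:R / 2 + e) - p%:R / 2 - 1) / (1 + c) ->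
    p%:R / 2 + a + 1 <= c * (n%:R / 2 + e - a).
  by rewrite ler_pdivlMr; lra.
split=> [a1 a2 hb|a1 /ltW a2 hb1 hb2].
  have h0 : 0 < p%:R / 2 + a + 1 by lra.
  have [q0 hq] := h_le _ _ h0 (a_le a2).
  have bcase : n%:R / 2 + e - a - 1 <= b \/ 0 <= b.
    by move: hb; rewrite ge_min => /orP[]; [left|right].
  (* In the case [q - 1 <= b] this is where [q > 0] enters. *)
  have b1 : -1 < b by case: bcase => ?; lra.
  apply: minimax_of_good_shrinkage => //.
  exact: good_shrinkage_of_ge.
rewrite lt_min => /andP[b0 _].
have h0 : 0 < p%:R / 2 + a + 1 by lra.
have [q0 hq] := h_le _ _ h0 (a_le a2).
have b1 : -1 < b by apply: lt_le_trans hb2.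
apply: minimax_of_good_shrinkage => //.
apply: (@good_shrinkage_of_neg _ _ _ _ _ _ h0 q0 b1 P2 n0 (- b)); [by rewrite opprK|lra|].
clear hb1 a_le h_le.
set h := p%:R / 2 + a + 1 in alpha h0 hq hb2 *; set q := n%:R / 2 + e - a in alpha q0 hq hb2 *.
have alpha0 : 0 < alpha by rewrite /alpha divr_gt0.
have den0 : 0 < 4 * (p%:R + a + 1) * (alpha + 1).
  by apply: mulr_gt0; [rewrite /h in h0; lra|lra].
have : - b <= (n%:R + 2) * (c - alpha) / (4 * (p%:R + a + 1) * (alpha + 1)) by lra.
rewrite ler_pdivlMr// mulrBr cE -(ler_pM2r q0).
(* Uses [4 (p + a + 1) = 2 p + 4 h] and [(alpha + 1) q = q + h]. *)
have -> : - b * (4 * (p%:R + a + 1) * (alpha + 1)) * q =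
    - b * (q + h) * (2 * p%:R + 4 * h).
  by rewrite /alpha /h; field; rewrite gt_eqF.
have -> : (2 * (p%:R - 2) - (n%:R + 2) * alpha) * q =
    2 * (p%:R - 2) * q - (n%:R + 2) * h.
  by rewrite /alpha; field; rewrite gt_eqF.
by [].
Qed.
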